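(* The principle $\diamondsuit(\mathfrak r_P)$ implies that there exists a gruff ultrafilter on $\mathbb Q$.
   Context: $\mathbb Q$ and $\mathbb Q^+$ (positive rationals) carry the Euclidean subspace topology. A set is crowded if it has no isolated points, perfect if closed and crowded. A nonprincipal ultrafilter on $\mathbb Q$ is gruff if for every $A\in u$ there is a perfect $X\in u$ with $X\subseteq A$. A set $X\subseteq\mathbb Q^+$ is two-sided crowded if for every $x\in X$ and $\varepsilon>0$ there are $y,z\in X$ with $x-\varepsilon<y<x<z<x+\varepsilon$, and two-sided perfect if moreover closed in $\mathbb Q^+$. Let $\mathscr B$ be the family of two-sided perfect subsets of $\mathbb Q^+$ unbounded above, and $\mathscr P'$ the family of subsets of $\mathbb Q^+$ containing a member of $\mathscr B$. For $Y\subseteq\mathbb Q^+$ and $X\in\mathscr B$, say $X$ reaps $Y$ modulo $\mathscr P'$ if $X\setminus Y\notin\mathscr P'$ or $X\cap Y\notin\mathscr P'$. Identify $\mathcal P(\mathbb Q^+)$ with the Cantor space $2^{\mathbb Q^+}$, and each $2^\alpha$ ($\alpha<\omega_1$) with a Cantor space; a function $F:2^{<\omega_1}\to\mathcal P(\mathbb Q^+)$ is Borel if its restriction to each $2^\alpha$, $\alpha<\omega_1$, is Borel. $\diamondsuit(\mathfrak r_P)$ is the statement: for every Borel $F:2^{<\omega_1}\to\mathcal P(\mathbb Q^+)$ there is $g:\omega_1\to\mathscr B$ such that for every $f:\omega_1\to 2$, the set $\{\alpha<\omega_1: g(\alpha)\text{ reaps }F(f\restriction\alpha)\text{ modulo }\mathscr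 P'\}$ is stationary in $\omega_1$. *)

(* Defs.v *)
From mathcomp Require Import all_boot all_order all_algebra.
From mathcomp Require Import all_classical all_reals all_analysis.

Set Implicit Arguments.
Unset Strict Implicit.
Unset Printing Implicit Defensive.

Import Order.TTheory GRing.Theory Num.Theory.

Local Open Scope classical_set_scope.
Local Open Scope ring_scope.

Definition nonprincipal (T : Type) (u : set_system T) : Prop :=
  forall x : T, u <> principal_filter x.

(* [rat^o] carries the topology of the metric `|x - y|, i.e. the Euclidean
   subspace topology. *)
Definition gruff (u : set_system rat^o) : Prop :=
  [/\ UltraFilter u, nonprincipal u &
      forall A : set rat^o, u A ->
        exists X : set rat^o, [/\ perfect_set X, u X & X `<=` A]].

(* As a [set_type], [Qpos] has the topology induced from [rat^o], so [closed]
   on [set Qpos] means relatively closed in the positive rationals. *)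
Definition Qpos := set_type [set q : rat^o | 0 < q].

Definition two_sided_crowded (X : set Qpos) : Prop :=
  forall x : Qpos, X x -> forall e : rat, 0 < e ->
    exists y z : Qpos, [/\ X y, X z, \val x - e < \val y,
      \val y < \val x & \val x < \val z /\ \val z < \val x + e].

Definition two_sided_perfect (X : set Qpos) : Prop :=
  closed X /\ two_sided_crowded X.

Definition unbounded_above (X : set Qpos) : Prop :=
  forall r : rat, exists2 x : Qpos, X x & r < \val x.

Definition scrB : set (set Qpos) :=
  [set X | two_sided_perfect X /\ unbounded_above X].

Definition scrP' : set (set Qpos) :=
  [set A | exists2 X, scrB X & X `<=` A].

Definition reaps (X Y : set Qpos) : Prop :=
  ~ scrP' (X `\` Y) \/ ~ scrP' (X `&` Y).

(* [W] is a copy of the first uncountable ordinal; its elements play the role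
   of the ordinals below omega_1. *)
Definition is_omega1 d (W : orderType d) : Prop :=
  [/\ (forall A : set W, A !=set0 ->
         exists2 m, A m & forall x, A x -> (m <= x)%O),
      ~ countable [set: W] &
      forall a : W, countable [set b : W | (b < a)%O]].

Section Omega1.
Context {d : Order.disp_t} {W : orderType d}.

Definition unbounded (C : set W) : Prop :=
  forall a : W, exists2 b, C b & (a < b)%O.

(* [C] contains every limit [a] such that [C] is cofinal below [a]; the two
   hypotheses force [a] to be a nonzero limit. *)
Definition closed_in_omega1 (C : set W) : Prop :=
  forall a : W, (exists b, (b < a)%O) ->
    (forall b, (b < a)%O -> exists2 c, C c & (b < c < a)%O) -> C a.

Definition club (C : set W) : Prop := unbounded C /\ closed_in_omega1 C.

Definition stationary (S : set W) : Prop :=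
  forall C : set W, club C -> S `&` C !=set0.

Definition below (a : W) : Type := {b : W | (b < a)%O}.

Definition two_to (a : W) : Type := {ptws below a -> bool}.

Definition restr (f : W -> bool) (a : W) : two_to a := fun b => f (sval b).

End Omega1.

Arguments restr {d W} f a.

Definition borel_set (X : topologicalType) : set (set X) := <<s open >>.

Definition borel_fun (X Y : topologicalType) (f : X -> Y) : Prop :=
  forall B : set Y, borel_set B -> borel_set (f @^-1` B).

Definition chi (Y : set Qpos) : {ptws Qpos -> bool} := fun q => q \in Y.

(* A function on 2^{<omega_1}, the disjoint union of the 2^a, is given by the
   family of its restrictions to the 2^a. *)
Definition borel_family d (W : orderType d)
    (F : forall a : W, two_to a -> set Qpos) : Prop :=
  forall a : W, borel_fun (fun s : {ptws below a -> bool} => chi (F a s)).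

Definition diamond_rP d (W : orderType d) : Prop :=
  forall F : (forall a : W, two_to a -> set Qpos), borel_family F ->
    exists2 g : W -> set Qpos, (forall a, scrB (g a)) &
      forall f : W -> bool, stationary [set a | reaps (g a) (F a (restr f a))].

(* Main.v *)
Require Import Defs.
From mathcomp Require Import all_boot all_order all_algebra.
From mathcomp Require Import all_classical all_reals all_analysis.
From mathcomp Require Import zify lra.

(* A stage [a] of the construction knows a set [G a] guessed by the diamond,
   transported to a tree of words in each interval ]n, n+1[.  Three consequences
   of reaping are used.  Crowded sets containing short words are split by the
   letters at one position, so the guessed sets dominate guessed functions; a
   tower of such sets yields a P-point with a base indexed by omega_1; and, by an
   Ulam matrix, different stages can be reserved for different tasks.

   The ultrafilter is generated by an almost decreasing tower of closed crowded
   unbounded sets [X a].  Reaping decides every set A only up to an error S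
   containing no unbounded two-sided crowded set.  Such an S is the union of a set
   without right-crowded and a set without left-crowded subsets.  For one side
   the P-point decides, along the sequences of children, whether one can stay
   away from S; a path in that direction escapes from S after finitely many steps
   along which countable ordinals decrease, and domination bounds the number of
   these steps in advance.  Hence some later [X a] is disjoint from S up to a
   bounded set, and so the tower decides every set up to bounded sets. *)

Set Implicit Arguments.
Unset Strict Implicit.
Unset Printing Implicit Defensive.

Import Order.TTheory GRing.Theory Num.Theory.

Local Open Scope classical_set_scope.
Local Open Scope ring_scope.

(** * Binary trees in the rationals *)

(** Under the in-order coding by [node], with [true] meaning to the right, these words lie on side
    [b] of [w] and approach it as [j] grows. *)
Definition child (b : bool) (w : seq bool) (j : nat) (v : seq bool) :=
  w ++ b :: nseq j (~~ b) ++ v.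

Definition tree_crowded (b : bool) (C : set (seq bool)) :=
  forall w, C w -> forall j, exists v, C (child b w j v).

Definition side (b : bool) (x y : rat) := if b then x < y else y < x.

Lemma sideN b x y : side (~~ b) x y = side b y x.
Proof. by case: b. Qed.

Lemma side_irr b x : side b x x = false.
Proof. by case: b; rewrite /side ltxx. Qed.

Lemma side_trans b : transitive (side b).
Proof.
by case: b => y x z; rewrite /side => xy yz; [exact: lt_trans yz|exact: lt_trans xy].
Qed.

Lemma side_asym b x y : side b x y -> side b y x -> False.
Proof. by move=> xy /(side_trans xy); rewrite side_irr. Qed.

Lemma side_inj b c x y : side b x y -> side c x y -> b = c.
Proof.
by case: b; case: c => //= xy; rewrite /side => /(lt_trans xy); rewrite ltxx.
Qed.

Definition crowded_on (b : bool) (S : set rat) :=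
  forall x, S x -> forall e, 0 < e ->
    exists2 y, S y & side b x y /\ `|y - x| < e.

Definition crowded (S : set rat) := forall b, crowded_on b S.

Definition between (lo hi : rat) : set rat := [set x | lo < x < hi].

Lemma crowded_on_between b S lo hi :
  crowded_on b S -> crowded_on b (S `&` between lo hi).
Proof.
move=> cS x [Sx /andP[lx xh]] e e0.
have d0 : 0 < Num.min e (Num.min (x - lo) (hi - x)).
  by rewrite !lt_min e0 !subr_gt0 lx.
have [y Sy [sxy]] := cS x Sx _ d0.
rewrite !lt_min => /and3P[ye yl yh]; exists y => //.
split=> //; rewrite /between /=; move: yl yh.
by rewrite !ltr_distl => /andP[? ?] /andP[? ?]; apply/andP; split; lra.
Qed.

Lemma crowded_on_side b c S p :
  crowded_on b S -> crowded_on b (S `&` [set x | side c p x]).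
Proof.
move=> cS x [Sx spx] e e0.
have [|y [Sy /andP[y1 y2]] [sxy yx]] :=
    @crowded_on_between b S (if c then p else x - 1) (if c then x + 1 else p)
      cS x _ e e0.
  split=> //; move: spx; rewrite /between /side /=.
    by case: (c) => h; apply/andP; split; lra.
exists y => //; split=> //=; rewrite /side; by move: y1 y2; case: (c).
Qed.

Lemma crowded_side c S p : crowded S -> crowded (S `&` [set x | side c p x]).
Proof. by move=> cS b; apply: crowded_on_side. Qed.

Lemma crowded_between S lo hi : crowded S -> crowded (S `&` between lo hi).
Proof. by move=> cS b; apply: crowded_on_between. Qed.

Definition least_code (P : set rat) (x : rat) :=
  P x /\ forall y, P y -> (pickle x <= pickle y)%N.

(** Splitting always at the point of least code ensures that every point becomes a root after
    finitely many splittings. *)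
Definition first (P : set rat) : rat := xget 0 (least_code P).

Lemma firstP P : P !=set0 -> least_code P (first P).
Proof.
move=> [x0 Px0]; apply: xgetPex.
have ex : exists n, `[< exists2 x, P x & pickle x = n >].
  by exists (pickle x0); apply/asboolP; exists x0.
case: (ex_minnP ex) => m /asboolP[x Px xm] mle.
by exists x; split=> // y Py; rewrite xm mle//; apply/asboolP; exists y.
Qed.

(* For crowded [P] this is the order isomorphism from the binary tree of words,
   read in-order, onto [P]. *)
Fixpoint node (P : set rat) (w : seq bool) : rat :=
  if w is b :: w' then node (P `&` [set x | side b (first P) x]) w' else first P.

Lemma side_nonempty b P :
  crowded P -> P !=set0 -> (P `&` [set x | side b (first P) x]) !=set0.
Proof.
move=> cP /firstP[Pf _]; have [y Py [sy _]] := cP b _ Pf 1 ltr01.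
by exists y.
Qed.

Lemma node_in P w : crowded P -> P !=set0 -> P (node P w).
Proof.
elim: w P => [|b w IH] P cP P0 /=; first by have [] := firstP P0.
by have [] := IH _ (@crowded_side b _ (first P) cP) (side_nonempty b cP P0).
Qed.

Lemma node_cons_side P b w : crowded P -> P !=set0 -> side b (first P) (node P (b :: w)).
Proof.
move=> cP P0 /=.
by have [] := node_in w (@crowded_side b _ (first P) cP) (side_nonempty b cP P0).
Qed.

Lemma node_child P b w j v :
  crowded P -> P !=set0 -> side b (node P w) (node P (child b w j v)).
Proof.
rewrite /child; elim: w P => [|c w IH] P cP P0; first exact: node_cons_side.
exact: IH (crowded_side cP) (side_nonempty c cP P0).
Qed.

(** One letter [~~ b] more than [u] has at its beginning suffices to pass [u]. *)
Lemma node_lim_nil P b u : crowded P -> P !=set0 ->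
  exists j, forall v, side b (node P (nseq j (~~ b) ++ v)) (node P u).
Proof.
elim: u P => [|c u IH] P cP P0.
  by exists 1%N => v; rewrite -sideN; exact: node_cons_side.
have [->|cb] := eqVneq c b.
  exists 1%N => v; apply: (@side_trans b (first P)).
    by rewrite -sideN; exact: node_cons_side.
  exact: node_cons_side.
have {cb}-> : c = ~~ b by move: cb; case: (c); case: (b).
have [j jP] := IH _ (crowded_side cP) (side_nonempty (~~ b) cP P0).
by exists j.+1 => v; exact: jP.
Qed.

(** If [u] extends [w], its next letter is [b] and [node_lim_nil] applies in that subtree; otherwise
    the place where the words part already separates [u] from all words extending [w]. *)
Lemma node_lim P b w u : crowded P -> P !=set0 ->
  side b (node P w) (node P u) ->
  exists j, forall v, side b (node P (child b w j v)) (node P u).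
Proof.
rewrite /child; elim: w u P => [|d w IH] [|c u] P cP P0.
- by rewrite side_irr.
- move=> s; have /side_inj/(_ s) cb := node_cons_side c u cP P0; subst c.
  have [j jP] := node_lim_nil b u (crowded_side cP) (side_nonempty b cP P0).
  by exists j => v; exact: jP.
- move=> s; have := node_cons_side d w cP P0.
  rewrite -sideN => /side_inj/(_ s) db.
  by exists 0%N => v; rewrite -db sideN; exact: node_cons_side.
- have [->|dc] := eqVneq c d; first exact: IH (crowded_side cP) (side_nonempty d cP P0).
  have sd v := node_cons_side d v cP P0; have sc := node_cons_side c u cP P0.
  have cdN : c = ~~ d by move: dc; case: (c); case: (d).
  move=> s; have : side c (node P (d :: w)) (node P (c :: u)).
    by apply: (side_trans _ sc); rewrite cdN sideN.
  move=> /(side_inj s) bc; exists 0%N => v; apply: side_trans; last by rewrite bc; exact: sc.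
  by rewrite bc cdN sideN; exact: sd.
Qed.

Lemma node_between_nil P b u j : crowded P -> P !=set0 ->
  side b (node P u) (node P (nseq j (~~ b))) -> exists v, u = nseq j (~~ b) ++ v.
Proof.
elim: j P u => [|j IH] P u cP P0 s; first by exists u.
have sf := node_cons_side (~~ b) (nseq j (~~ b)) cP P0; rewrite sideN in sf.
have := side_trans s sf; case: u s => [|c u] s.
  by rewrite side_irr.
rewrite -sideN => /(side_inj (node_cons_side c u cP P0)) cb; subst c.
have [v ->] := IH _ _ (crowded_side cP) (side_nonempty (~~ b) cP P0) s.
by exists v.
Qed.

(** The interval from [w] to such a child lies in one cone of the tree, which lets crowdedness pass
    from rationals back to words. *)
Lemma node_between P b w u j : crowded P -> P !=set0 ->
  side b (node P w) (node P u) -> side b (node P u) (node P (child b w j [::])) ->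
  exists v, u = child b w j v.
Proof.
rewrite /child cats0; elim: w u P => [|d w IH] [|c u] P cP P0.
- by rewrite side_irr.
- move=> s; have /side_inj/(_ s) cb := node_cons_side c u cP P0; subst c => s2.
  have [v ->] := node_between_nil (crowded_side cP) (side_nonempty b cP P0) s2.
  by exists v.
- move=> s1 s2; have sd v := node_cons_side d v cP P0.
  have e1 := side_inj (sd _) s2; move: s1; rewrite -sideN => s1.
  by have := side_inj (sd _) s1; rewrite e1; case: (b).
- have [->|dc] := eqVneq c d.
    move=> s1 s2.
    have [v ->] := IH _ _ (crowded_side cP) (side_nonempty d cP P0) s1 s2.
    by exists v.
  have sd v := node_cons_side d v cP P0; have sc := node_cons_side c u cP P0.
  have cdN : c = ~~ d by move: dc; case: (c); case: (d).
  have sdc v : side c (node P (d :: v)) (node P (c :: u)).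
    by apply: (side_trans _ sc); rewrite cdN sideN.
  move=> s1 s2; have bc := side_inj s1 (sdc w); subst b.
  by case: (side_asym s2 (sdc _)).
Qed.

(** The codes of the successive roots increase strictly along the path towards [x] and never exceed
    the code of [x]. *)
Lemma node_surj P x : crowded P -> P x -> exists w, node P w = x.
Proof.
have [n] := ubnP (pickle x - pickle (first P))%N.
elim: n P => // n IH P le_n cP Px.
have P0 : P !=set0 by exists x.
have [Pf fle] := firstP P0.
have [<-|nx] := eqVneq (first P) x; first by exists [::].
pose b := first P < x.
have sb : side b (first P) x by rewrite /side /b; case: ltgtP nx.
have Q0 := side_nonempty b cP P0.
have [[Pq sq] _] := firstP Q0.
have lt_pq : (pickle (first P) < pickle (first (P `&` [set z | side b (first P) z])))%N.
  rewrite ltn_neqAle fle// andbT; apply/eqP => /(pcan_inj pickleK) e.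
  by move: sq; rewrite /= -e side_irr.
have [|w <-] := IH _ _ (@crowded_side b _ (first P) cP) (conj Px sb).
  have := fle _ Px; have [_ /(_ x (conj Px sb))] := firstP Q0; lia.
by exists (b :: w).
Qed.

Lemma image_node_crowded P b C : crowded P -> P !=set0 ->
  tree_crowded b C -> crowded_on b (node P @` C).
Proof.
move=> cP P0 cC _ [w Cw <-] e e0.
have [y Py [sy ye]] := cP b _ (node_in w cP P0) e e0.
have [u uy] := node_surj cP Py; subst y.
have [j jP] := node_lim cP P0 sy; have [v Cv] := cC w Cw j.
exists (node P (child b w j v)); first by exists (child b w j v).
have s1 := @node_child P b w j v cP P0; split => //.
move: s1 (jP v) ye; rewrite /side; case: (b) => s1 s2.
  by rewrite !ltr_distlC; lra.
by rewrite !ltr_distlC; lra.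
Qed.

Lemma preimage_node_crowded P b (V : set (seq bool)) (S : set rat) :
  crowded P -> P !=set0 -> crowded_on b S ->
  (forall x, S x -> exists2 w, V w & x = node P w) ->
  tree_crowded b [set w | V w /\ S (node P w)].
Proof.
move=> cP P0 cS SV w [Vw Sw] j.
have s := @node_child P b w j [::] cP P0.
have d0 : 0 < `|node P (child b w j [::]) - node P w|.
  rewrite normr_gt0 subr_eq0; apply/eqP => e; by move: s; rewrite e side_irr.
have [y Sy [sy yd]] := cS _ Sw _ d0; have [u Vu yu] := SV y Sy.
have [||v uv] := @node_between P b w u j cP P0.
- by rewrite -yu.
- rewrite -yu; move: s sy yd; rewrite /side; case: (b) => s sy.
    by rewrite gtr0_norm ?subr_gt0// gtr0_norm ?subr_gt0//; lra.
  by rewrite ltr0_norm ?subr_lt0// ltr0_norm ?subr_lt0//; lra.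
by exists v; rewrite -uv; split=> //=; rewrite -yu.
Qed.

(** * Closed crowded subsets *)

Definition unbounded_rat (S : set rat) := forall r, exists2 x, S x & r < x.

Definition outside (B : seq (rat * rat)) : set rat :=
  [set x | forall c, c \in B -> c.2 < `|x - c.1|].

Lemma separating_radius (F : seq rat) q :
  q \notin F -> exists2 r, 0 < r & forall x, x \in F -> r < `|x - q|.
Proof.
elim: F => [|y F IH]; first by exists 1.
rewrite inE negb_or => /andP[qy /IH[r r0 rP]].
have y0 : 0 < `|y - q| by rewrite normr_gt0 subr_eq0 eq_sym.
exists (Num.min r (`|y - q| / 2)); first by rewrite lt_min r0 divr_gt0.
move=> x; rewrite inE gt_min => /orP[/eqP ->|/rP ->//].
by apply/orP; right; lra.
Qed.

Lemma outside_open B x : outside B x ->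
  exists2 d, 0 < d & forall y, `|y - x| < d -> outside B y.
Proof.
elim: B => [|c B IH] xB; first by exists 1 => // y _ c; rewrite in_nil.
have [z zB|d d0 dP] := IH; first by apply: xB; rewrite inE zB orbT.
have xc : c.2 < `|x - c.1| by apply: xB; rewrite mem_head.
exists (Num.min d (`|x - c.1| - c.2)); first by rewrite lt_min d0 subr_gt0.
move=> y; rewrite lt_min => /andP[/dP yB yx] z; rewrite inE => /orP[/eqP ->|/yB//].
have := ler_distD y x c.1; rewrite (distrC x y); lra.
Qed.

Lemma outside_large B : exists M, forall y, M < y -> outside B y.
Proof.
elim: B => [|c B [M MP]]; first by exists 0 => y _ c; rewrite in_nil.
exists (Num.max M (c.1 + c.2)) => y; rewrite gt_max => /andP[/MP yB yc] z.
rewrite inE => /orP[/eqP ->|/yB//].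
have := ler_norm (y - c.1); lra.
Qed.

Section ClosedSubset.
Variable C : set rat.
Hypothesis (cC : crowded C) (uC : unbounded_rat C).

(* A state consists of the points committed to the subset being built and of
   the closed balls excluded from it. *)
Let state := {s : seq rat * seq (rat * rat) |
  forall x, x \in s.1 -> C x /\ outside s.2 x}.

(** The clauses serve, in turn, monotonicity, closedness of the final set, its crowdedness and its
    unboundedness. *)
Let step (k : nat) (s t : state) :=
  [/\ {subset (sval s).1 <= (sval t).1} /\ {subset (sval s).2 <= (sval t).2},
      forall q : rat, unpickle k = Some q -> q \in (sval s).1 \/
        exists2 r, 0 < r & (q, r) \in (sval t).2,
      forall x b, x \in (sval s).1 -> exists2 y, y \in (sval t).1 &
        side b x y /\ `|y - x| < k.+1%:R^-1 &
      exists2 y, y \in (sval t).1 & k%:R < y].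

Let stepP k s : exists t, step k s t.
Proof.
case: s => -[F B] /= FB.
have [B' [sB B'F B'k]] : exists B', [/\ {subset B <= B'},
    forall x, x \in F -> outside B' x &
    forall q : rat, unpickle k = Some q -> q \in F \/
        exists2 r, 0 < r & (q, r) \in B'].
  case uk: (unpickle k : option rat) => [q|]; last by exists B; split=> // x /FB[].
  have [qF|qF] := boolP (q \in F).
    by exists B; split=> // [x /FB[]//|_ [<-]]; left.
  have [r r0 rP] := separating_radius qF.
  exists ((q, r) :: B); split=> [c cB|x xF|_ [<-]].
  - by rewrite inE cB orbT.
  - move=> c; rewrite inE => /orP[/eqP ->|]; first exact: rP.
    by have [_ /(_ c)] := FB _ xF.
  - by right; exists r; rewrite ?mem_head.
have nearP (xb : rat * bool) : exists y, xb.1 \in F ->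
    [/\ C y, outside B' y, side xb.2 xb.1 y & `|y - xb.1| < k.+1%:R^-1].
  case: xb => x b /=; have [xF|_] := boolP (x \in F); last by exists 0.
  have [d d0 dP] := outside_open (B'F _ xF).
  have e0 : 0 < Num.min d k.+1%:R^-1 by rewrite lt_min d0 invr_gt0 ltr0n.
  have [y Cy [sy]] := cC b (FB _ xF).1 e0.
  by rewrite lt_min => /andP[yd yk]; exists y => _; split=> //; exact: dP.
have [h hP] := choice nearP.
have [M MP] := outside_large B'.
have [z Cz] := uC (Num.max M k%:R); rewrite gt_max => /andP[zM zk].
pose F' := z :: F ++ [seq h xb | xb <- [seq (x, b) | x <- F, b <- [:: true; false]]].
have F'P x : x \in (F', B').1 -> C x /\ outside (F', B').2 x.
  rewrite /= inE mem_cat => /or3P[/eqP ->|xF|/mapP[xb /allpairsP[[y b] /= [yF _ ->]] ->]].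
  - by split=> //; exact: MP.
  - by split; [have [] := FB _ xF|exact: B'F].
  - by have [] := hP (y, b) yF.
exists (exist _ (F', B') F'P); split=> //=.
- by split=> // x xF; rewrite inE mem_cat xF orbT.
- move=> x b xF; exists (h (x, b)); last by have [] := hP (x, b) xF.
  rewrite inE mem_cat; apply/or3P; apply: Or33; apply/map_f/allpairsP.
  by exists (x, b); split=> //; case: (b).
- by exists z => //; rewrite mem_head.
Qed.

(** A fusion of countably many finite stages: the set consists of all points ever committed, and a
    ball excluded at some stage is avoided by all of them. *)
Lemma closed_crowded_subset : exists X : set rat,
  [/\ X `<=` C, closed (X : set rat^o), crowded X & unbounded_rat X].
Proof.
have [nxt nxtP] := choice (fun ks : nat * state => stepP ks.1 ks.2).
pose s0 : seq rat * seq (rat * rat) := ([::], [::]).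
have s0P x : x \in s0.1 -> C x /\ outside s0.2 x by [].
pose st := fix st k : state := if k is k'.+1 then nxt (k', st k') else exist _ _ s0P.
have stP k : step k (st k) (st k.+1) by exact: (nxtP (k, st k)).
have mono k l : (k <= l)%N -> {subset (sval (st k)).1 <= (sval (st l)).1} /\
    {subset (sval (st k)).2 <= (sval (st l)).2}.
  elim: l => [|l IH]; first by rewrite leqn0 => /eqP ->.
  rewrite leq_eqVlt => /orP[/eqP ->|/IH[i1 i2]]; first by split.
  by have [[j1 j2] _ _ _] := stP l; split=> x xk; [exact/j1/i1|exact/j2/i2].
pose X := [set x | exists k, x \in (sval (st k)).1].
exists X; split.
- by move=> x [k /(svalP (st k))[]].
- rewrite -[X]setCK; apply: open_closedC; rewrite openE => q Xq.
  have [_ /(_ q (pickleK q)) [qX|[r r0 rP] _ _]] := stP (pickle q).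
    by case: Xq; exists (pickle q).
  apply/nbhs_ballP; exists r => //= y yq [k ky].
  have [/(_ y) yM _] := mono _ _ (leq_addr (pickle q).+1 k).
  have [_ rM] := mono _ _ (leq_addl k (pickle q).+1).
  have [_ /(_ _ (rM _ rP)) /=] := svalP (st (k + (pickle q).+1)) y (yM ky).
  by rewrite distrC; move: yq; rewrite /ball /= => yq /(lt_trans yq); rewrite ltxx.
(* At stage [l] the point [x] is committed and [1/(l+1)] is below [e]. *)
- move=> b x [k xk] e e0; pose l := (k + Num.truncn e^-1)%N.
  have [/(_ x xk) xl _] := mono k l (leq_addr _ _).
  have [_ _ /(_ x b xl)[y yl [sy yx]] _] := stP l.
  exists y; first by exists l.+1.
  split=> //; apply: lt_trans yx _; rewrite invf_plt ?posrE ?ltr0n//.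
  apply: lt_le_trans (truncnS_gt _) _.
  by rewrite ler_nat ltnS leq_addl.
- move=> r; pose k := Num.truncn r; have [_ _ _ [y yk ky]] := stP k.+1.
  exists y; first by exists k.+2.
  exact: lt_trans (truncnS_gt _) ky.
Qed.

End ClosedSubset.

(** * The order omega_1 *)

Section Omega1Facts.
Context {d : Order.disp_t} {W : orderType d}.
Hypothesis hW : is_omega1 W.
Local Open Scope order_scope.
Local Open Scope classical_set_scope.

Lemma omega1_ind (P : W -> Prop) :
  (forall a, (forall b, b < a -> P b) -> P a) -> forall a, P a.
Proof.
case: hW => minW _ _ IH a; apply: contrapT => nPa.
have [|m nPm mle] := minW [set x | ~ P x]; first by exists a.
apply: nPm; apply: IH => b bm; apply: contrapT => nPb.
by have := mle b nPb; rewrite leNgt bm.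
Qed.

Lemma omega1_rec (X : Type) (x0 : X) (F : W -> (W -> X) -> X) :
  exists h, forall a, h a = F a (fun b => if b < a then h b else x0).
Proof.
have wf : well_founded (fun a b : W => a < b).
  by move=> a; elim/omega1_ind: a => a IH; constructor.
pose G a (f : forall b, b < a -> X) :=
  F a (fun b => if pselect (is_true (b < a)) is left ba then f b ba else x0).
exists (Fix wf (fun=> X) G) => a; rewrite Fix_eq.
  rewrite /G; congr (F a); apply: funext => b.
  by case: pselect => [->//|/negP/negbTE ->].
move=> x f g fg; rewrite /G; congr (F x); apply: funext => b.
by case: pselect => // bx; exact: fg.
Qed.

Lemma countable_bounded (A : set W) : countable A -> exists b, forall a, A a -> a < b.
Proof.
case: hW => _ ncW ctW cA; apply: contrapT => nb; apply: ncW.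
have -> : [set: W] = A `|` \bigcup_(a in A) [set b | b < a].
  rewrite eqEsubset; split=> // x _.
  have /existsNP[a /not_implyP[Aa /negP]] : ~ forall a, A a -> a < x.
    by move=> h; apply: nb; exists x.
  rewrite -leNgt le_eqVlt => /orP[/eqP ->|xa]; first by left.
  by right; exists a.
have cB : countable (\bigcup_(a in A) [set b | b < a]).
  by apply: bigcup_countable => // a _; exact: ctW.
rewrite -(bigcup2E A); apply: bigcup_countable => // -[|[|i]] _ //=.
Qed.

Lemma omega1_bound : exists bnd : set W -> W,
  forall A, countable A -> forall a, A a -> a < bnd A.
Proof.
suff /choice[f fP] : forall A : set W, exists b, countable A -> forall a, A a -> a < b.
  by exists f.
move=> A; have [/countable_bounded[b bP]|nA] := pselect (countable A).
  by exists b.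
case: hW => _ ncW _; have /set0P[b _] : [set: W] != set0.
  by apply/eqP => e; apply: ncW; rewrite e; exact: countable0.
by exists b.
Qed.

(** Closure under countably many finitary operations; the clubs of this form are the only ones
    against which stationarity is used. *)
Definition closed_under (c : nat -> seq W -> W) (a : W) :=
  forall k s, all (fun x => x < a) s -> c k s < a.

Lemma below_injection : exists e : W -> W -> nat,
  forall a x y, x < a -> y < a -> e a x = e a y -> x = y.
Proof.
case: hW => _ _ ctW.
have [e eP] := choice (fun a => elimT (countable_injP _) (ctW a)).
by exists e => a x y xa ya /eP -> //; rewrite inE.
Qed.

Lemma seq_below_countable a : countable [set s : seq W | all (fun x => x < a) s].
Proof.
have [e eP] := below_injection.
apply/countable_injP; exists (fun s => pickle (map (e a) s)) => s t.
rewrite !inE /= => sa ta /(pcan_inj pickleK).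
elim: s t sa ta => [|x s IH] [|y t] //= /andP[xa sa] /andP[ya ta] [exy est].
by rewrite (eP a x y) // (IH t).
Qed.

(** The witness is the supremum of an omega-sequence in which each term bounds the values of all
    operations at lists below the previous term. *)
Lemma closed_under_unbounded c a : exists2 b, closed_under c b & a < b.
Proof.
case: (hW) => minW _ _.
have [bnd bndP] := omega1_bound.
pose A x := [set x] `|` \bigcup_k [set c k s | s in [set s | all (fun z => z < x) s]].
have cA x : countable (A x).
  rewrite /A -bigcup2E; apply: bigcup_countable => // -[|[|i]] _ /=.
  - exact: countable1.
  - apply: bigcup_countable => // k _.
    exact: sub_countable (card_image_le _ _) (seq_below_countable x).
  - by [].
pose u n := iter n (fun x => bnd (A x)) (bnd [set a]).
have uS n : u n < u n.+1 by apply: bndP => //; left.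
have [|m mub mle] := minW [set b | forall n, u n < b].
  have [b bP] := @countable_bounded (range u) (sub_countable (card_image_le _ _) (countableP _)).
  by exists b => n; apply: bP; exists n.
exists m; last by apply: lt_trans (mub 0%N); apply: bndP => //; exact: countable1.
have mono n k : u n <= u (n + k)%N.
  by elim: k => [|k IH]; rewrite ?addn0// addnS; apply: le_trans IH (ltW (uS _)).
have below x : x < m -> exists n, x < u n.
  move=> xm; apply: contrapT => nx.
  suff /mle : [set b | forall n, u n < b] x by rewrite leNgt xm.
  move=> n; apply: lt_le_trans (uS n) _; rewrite leNgt; apply/negP => xu.
  by apply: nx; exists n.+1.
move=> k s; suff: all (fun x => x < m) s -> exists n, all (fun x => x < u n) s.
  move=> /[apply] -[n sn]; apply: lt_trans (mub n.+1).
  by apply: bndP => //; right; exists k => //; exists s.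
elim: s => [_|x s IH /= /andP[/below[n xn] /IH[l sl]]]; first by exists 0%N.
exists (n + l)%N; rewrite (lt_le_trans xn (mono _ _)) /=.
by apply: sub_all sl => z zl; apply: lt_le_trans zl _; rewrite addnC mono.
Qed.

Lemma club_closed_under c : club (closed_under c).
Proof.
split=> [a|a [a0 a0a] aC k s sa]; first exact: closed_under_unbounded.
have [b ba sb] : exists2 b, b < a & all (fun x => x <= b) s.
  elim: s sa => [_|x s IH /= /andP[xa /IH[b ba sb]]]; first by exists a0.
  exists (Order.max x b); first by rewrite gt_max xa.
  rewrite le_max lexx /=; apply: sub_all sb => z zb.
  by rewrite le_max zb orbT.
have [g gC /andP[bg ga]] := aC _ ba.
by apply: lt_trans ga; apply: gC; apply: sub_all sb => z /le_lt_trans; apply.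
Qed.

Definition stat (S : set W) := forall c, exists a, S a /\ closed_under c a.

Lemma stationary_stat S : stationary S -> stat S.
Proof. by move=> sS c; have [a [Sa ca]] := sS _ (club_closed_under c); exists a. Qed.

(** The ordinals [lam a k] form disjoint countable blocks. A list is coded in the block of its bound
    [top s], through an injection into the naturals of the ordinals below [top s]. *)
Lemma seq_code : exists code : seq W -> nat -> W,
  forall s t k l, code s k = code t l -> s = t /\ k = l.
Proof.
have [bnd bndP] := omega1_bound; have [e eP] := below_injection.
pose sc x := bnd [set x].
have scP x : x < sc x by apply: bndP => //; exact: countable1.
have [base baseP] := omega1_rec (bnd set0)
  (fun a f => bnd (\bigcup_(b in [set b | b < a]) range (fun k => iter k sc (f b)))).
pose lam a k := iter k sc (base a).
have lamS a k l : (k < l)%N -> lam a k < lam a l.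
  elim: l => // l IH; rewrite ltnS leq_eqVlt => /orP[/eqP ->|/IH kl]; first exact: scP.
  exact: lt_trans kl (scP _).
have lam_lt a b k l : a < b -> lam a k < lam b l.
  move=> ab; apply: (@lt_le_trans _ _ (lam b 0%N)).
    rewrite /lam /= [base b]baseP; apply: bndP.
      case: (hW) => _ _ ctW; apply: bigcup_countable => // x _.
      exact: sub_countable (card_image_le _ _) (countableP _).
    by exists a => //; exists k; rewrite // ab.
  by case: l => // l; apply/ltW/lamS.
have lam_inj a b k l : lam a k = lam b l -> a = b /\ k = l.
  case: (ltgtP a b) => [ab|ba|<-] ekl.
  - by have := lam_lt _ _ k l ab; rewrite ekl ltxx.
  - by have := lam_lt _ _ l k ba; rewrite ekl ltxx.
  - split=> //; case: (ltngtP k l) => // kl; have := lamS a _ _ kl; rewrite ekl ?ltxx//.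
pose top (s : seq W) := bnd [set x | x \in s].
have topP s : all (fun x => x < top s) s.
  by apply/allP => x xs; apply: bndP => //; apply: finite_set_countable; exact: finite_seq.
exists (fun s k => lam (top s) (pickle (map (e (top s)) s, k))).
move=> s t k l /lam_inj[est]; rewrite -est => /(pcan_inj pickleK)[mst ->]; split=> //.
move: (topP s) (topP t) mst; rewrite -est; move: (top s) => a {est}.
elim: s t => [|x s IH] [|y t] //= /andP[xa sa] /andP[ya ta] [exy est].
by rewrite (eP a x y) // (IH t).
Qed.

(** [rk x] is the stage at which [x] enters the transfinite iteration of [G] from the empty set; the
    second hypothesis makes this iteration exhaust [X]. *)
Lemma monotone_rank (X : countType) (G : set X -> set X) :
  (forall A B, A `<=` B -> G A `<=` G B) ->
  (forall D, G D `<=` D -> forall x, D x) ->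
  exists rk : X -> W, forall x, G [set y | rk y < rk x] x.
Proof.
case: (hW) => minW _ _ monoG lfpG.
have [h hE] := omega1_rec set0 (fun a (f : W -> set X) => G [set x | exists2 b, b < a & f b x]).
have {}hE a : h a = G [set x | exists2 b, b < a & h b x].
  rewrite hE; congr G; apply/seteqP; split=> x [b ba]; first by rewrite ba => ?; exists b.
  by move=> hbx; exists b; rewrite // ba.
have hT : forall x, exists a, h a x.
  apply: (lfpG [set x | exists a, h a x]) => x Gx.
  have /choice[f fP] : forall y, exists a, (exists a', h a' y) -> h a y.
    move=> y; have [[a hay]|n] := pselect (exists a, h a y); first by exists a.
    case: (minW setT) => [|m _ _]; last by exists m.
    by have [bnd _] := omega1_bound; exists (bnd set0).
  (* As [X] is countable, one stage [b] lies above all stages of entry, so the union of the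
     iteration is closed under [G]. *)
  have [b bP] := @countable_bounded (range f) (sub_countable (card_image_le _ _) (countableP _)).
  exists b; rewrite hE; apply: monoG Gx => y yh; exists (f y); last exact: fP.
  by apply: bP; exists y.
have /choice[rk rkP] : forall x, exists m, h m x /\ forall a, h a x -> m <= a.
  by move=> x; have [|m hm mle] := minW [set a | h a x]; [exact: hT|exists m].
exists rk => x; have [] := rkP x; rewrite hE => Gx _.
apply: monoG Gx => y [b brk hby] /=.
by have [_ /(_ b hby)] := rkP y => /le_lt_trans; apply.
Qed.

(** The decreasing sequences through the finite lists [R i] form a finitely branching tree without
    infinite branches, so its height is finite; the bound is found by induction on the first
    term. *)
Lemma bounded_descent (R : nat -> seq W) : exists n, forall o : nat -> W,
  (forall i, (i <= n)%N -> o i \in R i) -> exists2 i, (i < n)%N & ~~ (o i.+1 < o i).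
Proof.
have H : forall w i, exists n, forall o : nat -> W, o 0%N = w ->
    (forall j, (j <= n)%N -> o j \in R (i + j)%N) ->
    exists2 j, (j < n)%N & ~~ (o j.+1 < o j).
  elim/omega1_ind => w IH i.
  have /choice[f fP] : forall v, exists n, v < w -> forall o : nat -> W, o 0%N = v ->
      (forall j, (j <= n)%N -> o j \in R (i.+1 + j)%N) ->
      exists2 j, (j < n)%N & ~~ (o j.+1 < o j).
    move=> v; have [vw|nvw] := boolP (v < w); last by exists 0%N.
    by have [n nP] := IH v vw i.+1; exists n.
  exists (\max_(v <- R i.+1) f v).+1 => o o0 oR.
  have [lt1|nlt1] := boolP (o 1%N < w); last by exists 0%N; rewrite // o0.
  have o1R : o 1%N \in R i.+1 by have := oR 1%N isT; rewrite addn1.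
  have fle : (f (o 1%N) <= \max_(v <- R i.+1) f v)%N by rewrite leq_bigmax_seq.
  have [|j jl oj] := fP _ lt1 (fun j => o j.+1) erefl.
    by move=> j jf; rewrite addSnnS; apply: oR; rewrite ltnS (leq_trans jf).
  by exists j.+1; rewrite // ltnS (leq_trans jl).
have /choice[f fP] : forall v, exists n, forall o : nat -> W, o 0%N = v ->
    (forall j, (j <= n)%N -> o j \in R j) -> exists2 j, (j < n)%N & ~~ (o j.+1 < o j).
  by move=> v; exact: (H v 0%N).
exists (\max_(v <- R 0%N) f v)%N => o oR.
have fle : (f (o 0%N) <= \max_(v <- R 0%N) f v)%N by rewrite leq_bigmax_seq// oR.
have [|j jl oj] := fP _ o erefl; first by move=> j jf; apply/oR/(leq_trans jf).
by exists j; rewrite // (leq_trans jl).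
Qed.

Lemma omega1_enum : exists eps : W -> nat -> W, forall a, (exists b, b < a) ->
  (forall k, eps a k < a) /\ (forall b, b < a -> exists k, eps a k = b).
Proof.
have [e eP] := below_injection.
suff /choice[eps epsP] : forall a, exists f : nat -> W, (exists b, b < a) ->
  (forall k, f k < a) /\ (forall b, b < a -> exists k, f k = b) by exists eps.
move=> a; have [[b0 b0a]|nb] := pselect (exists b, b < a); last by exists (fun=> a).
have /choice[f fP] : forall k, exists b, b < a /\ forall x, x < a -> e a x = k -> b = x.
  move=> k; have [[x [xa xk]]|nx] := pselect (exists x, x < a /\ e a x = k).
    by exists x; split=> // y ya yk; apply: eP xa ya _; rewrite xk.
  by exists b0; split=> // x xa xk; case: nx; exists x.
exists f => _; split=> [k|b ba]; first by have [] := fP k.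
by exists (e a b); have [_ /(_ b ba erefl)] := fP (e a b).
Qed.

End Omega1Facts.

(** * Reaping in trees *)

(** The integers lie in no block; this later lets a closed set built inside the blocks be cut at an
    integer without losing closedness. *)
Definition block (n : nat) : set rat := between n%:R n.+1%:R.

Lemma block_inj m n x : block m x -> block n x -> m = n.
Proof.
move=> /andP[mx xm] /andP[nx xn].
have : m%:R < n.+1%:R :> rat by exact: lt_trans mx xn.
have : n%:R < m.+1%:R :> rat by exact: lt_trans nx xm.
by rewrite !ltr_nat; lia.
Qed.

Lemma setT_crowded : crowded setT.
Proof.
move=> b x _ e e0; exists (if b then x + e / 2 else x - e / 2) => //.
rewrite /side; case: b; split; rewrite ?ltr_distlC; try lra.
Qed.

Lemma block_crowded n : crowded (block n).
Proof. by rewrite -[block n]setTI; exact/crowded_between/setT_crowded. Qed.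

Lemma block_nonempty n : block n !=set0.
Proof.
exists (n%:R + 1 / 2); rewrite /block /between /=.
by rewrite -[n.+1]addn1 natrD; apply/andP; split; lra.
Qed.

Lemma crowded_meets_block S r : crowded S -> unbounded_rat S ->
  exists n z, [/\ r < n%:R :> rat, S z & block n z].
Proof.
(* The summand 1 keeps the integer part of [x] above [r]. *)
move=> cS uS; have [x Sx] := uS (Num.max r 0 + 1).
rewrite -ltrBrDr gt_max => /andP[rx x0].
have /truncn_itv/andP[tx xt] : 0 <= x by lra.
have e0 : 0 < (Num.truncn x).+1%:R - x by rewrite subr_gt0.
(* [x] may itself be an integer, so it is replaced by a point slightly to its right. *)
have [z Sz [/= sz zx]] := cS true x Sx _ e0.
exists (Num.truncn x), z; split=> //; last first.
  move: zx; rewrite /block /between /= ltr_distlC => /andP[? ?].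
  by apply/andP; split; lra.
by move: xt; rewrite -[_.+1]addn1 natrD; lra.
Qed.

Lemma node_inj P w u : crowded P -> P !=set0 -> node P w = node P u -> w = u.
Proof.
elim: w u P => [|c w IH] [|e u] P cP P0 //.
- by move=> ewu; have := node_cons_side e u cP P0; rewrite -ewu side_irr.
- by move=> ewu; have := node_cons_side c w cP P0; rewrite ewu side_irr.
- move=> ewu; have sw := node_cons_side c w cP P0.
  have := node_cons_side e u cP P0; rewrite -ewu => /(side_inj sw) ce; subst e.
  by rewrite (IH u _ (crowded_side cP) (side_nonempty c cP P0) ewu).
Qed.

Definition blocks_crowded (V : nat -> set (seq bool)) :=
  forall n b, tree_crowded b (V n).

Definition blocks_unbounded (V : nat -> set (seq bool)) :=
  forall m, exists2 n, (m <= n)%N & V n !=set0.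

(** The form taken on words by not belonging to [scrP']; closedness is restored by
    [closed_crowded_subset]. *)
Definition small (S : nat -> set (seq bool)) := ~ exists C,
  [/\ forall n, C n `<=` S n, blocks_crowded C & blocks_unbounded C].

Definition tree_reaps (G Y : nat -> set (seq bool)) :=
  small (fun n => G n `\` Y n) \/ small (fun n => G n `&` Y n).

Lemma blocks_preimage_crowded S : crowded S ->
  blocks_crowded (fun n => [set w | S (node (block n) w)]).
Proof.
move=> cS n b w Sw j; have cB := @block_crowded n; have B0 := block_nonempty n.
have cSB : crowded_on b (S `&` block n) by exact: crowded_on_between.
have [||v [_ [Sv _]]] := @preimage_node_crowded _ b setT _ cB B0 cSB _ w _ j.
- by move=> x [_ /(node_surj cB)[u ux]]; exists u.
- by split=> //; split=> //; exact: node_in.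
- by exists v.
Qed.

(** Preimages of cylinders are finite intersections of open sets and complements of open sets. Since
    [Qpos] is countable, there are only countably many cylinders, and every open set is a union of
    some of them. *)
Lemma borel_fun_chi (T : topologicalType) (F : T -> set Qpos) :
  (forall q, open [set s | F s q]) ->
  borel_fun (fun s : T => chi (F s) : {ptws Qpos -> bool}).
Proof.
move=> oF; pose f (s : T) : {ptws Qpos -> bool} := chi (F s); rewrite -/f.
have bor A : open A -> borel_set (A : set T) by exact: sub_sigma_algebra.
have borC A : borel_set A -> borel_set (~` A : set T).
  by move=> bA; rewrite -setTD; exact: sigma_algebraCD.
have borU (A : nat -> set T) : (forall n, borel_set (A n)) -> borel_set (\bigcup_n A n).
  exact: sigma_algebra_bigcup.
have borI A B : borel_set A -> borel_set B -> borel_set (A `&` B : set T).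
  move=> bA bB; rewrite -[A]setCK -[B]setCK -setCU; refine (borC _ _).
  by rewrite -bigcup2E; apply: borU => -[|[|n]] /=; [exact: (borC)|exact: (borC)|exact: (bor _ open0)].
(* Lists over [rat] can be enumerated by [unpickle]; an entry whose rational is not positive imposes
   no condition. *)
pose cyl (l : seq (rat * bool)) : set {ptws Qpos -> bool} :=
  [set y | forall (q : Qpos) b, (\val q, b) \in l -> y q = b].
have bor_cyl l : borel_set (f @^-1` cyl l).
  elim: l => [|[r b] l IH].
    by rewrite (_ : _ @^-1` _ = setT); [exact: bor openT|apply/seteqP; split].
  have -> : f @^-1` cyl ((r, b) :: l) =
      f @^-1` cyl l `&` [set s | forall q : Qpos, \val q = r -> f s q = b].
    apply/seteqP; split=> s /=.
      move=> sl; split=> [q c qc|q qr]; first by apply: sl; rewrite inE qc orbT.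
      by apply: sl; rewrite -qr mem_head.
    move=> [sl sr] q c; rewrite inE => /orP[/eqP[qr ->]|]; last exact: sl.
    exact: sr.
  apply: borI => //.
  have [[q qr]|nq] := pselect (exists q : Qpos, \val q = r); last first.
    rewrite (_ : [set s | _] = setT); first exact: bor openT.
    by apply/seteqP; split=> // s _ q qr; case: nq; exists q.
  have -> : [set s | forall q : Qpos, \val q = r -> f s q = b] = [set s | f s q = b].
    apply/seteqP; split=> s /=; first exact.
    by move=> fs q'; rewrite -qr => /val_inj ->.
  have -> : [set s | f s q = b] = if b then [set s | F s q] else ~` [set s | F s q].
    case: (b); apply/seteqP; split=> s; rewrite /f /chi /=.
    - by move/set_mem.
    - by move=> Fs; apply/mem_set.
    - by move=> Fs /mem_set; rewrite Fs.
    - by move=> Fs; apply/negbTE/negP => /set_mem.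
  by case: (b); [exact: (bor _ (oF q))|exact: (borC _ (bor _ (oF q)))].
have bor_open U : open U -> borel_set (f @^-1` U).
  move=> oU.
  pose A n : set {ptws Qpos -> bool} := [set y | exists l,
    [/\ unpickle n = Some l, cyl l y & cyl l `<=` U]].
  have -> : f @^-1` U = \bigcup_n f @^-1` A n.
    apply/seteqP; split=> s; last by move=> [n _] [l [_ ls]]; exact.
    (* The filter generated by the cylinders around [f s] converges pointwise to [f s], so [U]
       contains one of them. *)
    move=> Us; pose Fl : set_system {ptws Qpos -> bool} :=
      [set B | exists2 l, cyl l (f s) & cyl l `<=` B].
    have FlF : Filter Fl.
      constructor; first by exists [::].
        move=> B C [l ls lB] [k ks kC]; exists (l ++ k).
          by move=> q b; rewrite mem_cat => /orP[/ls|/ks].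
        move=> y ly; split; [apply: lB|apply: kC] => q b qb; apply: ly;
          by rewrite mem_cat qb ?orbT.
      by move=> B C BC [l ls lB]; exists l => //; exact: subset_trans BC.
    have : {ptws, Fl --> f s}.
      apply/pointwise_cvgP => t B /nbhs_singleton Bt; exists [:: (\val t, f s t)].
        by move=> q b; rewrite inE => /eqP[/val_inj -> ->].
      by move=> y yl /=; rewrite (yl t (f s t)) ?mem_head.
    move=> /(_ U) [|l ls lU]; first exact: open_nbhs_nbhs.
    by exists (pickle l) => //; exists l; rewrite pickleK.
  apply: borU => n; case un: (unpickle n : option (seq (rat * bool))) => [l|]; last first.
    rewrite (_ : A n = set0) ?preimage_set0; first exact: (bor _ open0).
    by apply/seteqP; split=> // y [l []]; rewrite un.
  have [lU|nlU] := pselect (cyl l `<=` U).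
    rewrite (_ : A n = cyl l) //; apply/seteqP; split=> y; last by exists l.
    by move=> [k []]; rewrite un => -[->].
  rewrite (_ : A n = set0) ?preimage_set0; first exact: (bor _ open0).
  by apply/seteqP; split=> // y [k []]; rewrite un => -[<-].
move=> B; rewrite /borel_set.
have : sigma_algebra setT [set A | borel_set (f @^-1` A)].
  split=> [|A /= bA|A bA /=]; first by rewrite /= preimage_set0; exact: bor open0.
    by rewrite setTD preimage_setC; exact: borC.
  by rewrite preimage_bigcup; exact: borU.
by move=> sa; apply: (smallest_sub sa).
Qed.

Lemma crowded_bigcup b (F : nat -> set rat) :
  (forall n, crowded_on b (F n)) -> crowded_on b (\bigcup_n F n).
Proof.
move=> cF x [n _ Fx] e e0; have [y Fy sy] := cF n x Fx e e0.
by exists y => //; exists n.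
Qed.

Lemma closed_val_preimage (X : set rat^o) : closed X ->
  closed [set x : Qpos | X (\val x)].
Proof.
move=> cX; apply: (@preimage_closed Qpos rat^o (fun x : Qpos => \val x)) => // x _.
exact: initial_continuous.
Qed.

(** A crowded unbounded family of words in [C0] maps onto a crowded unbounded set of rationals, and
    a closed one inside it yields a member of [scrB] contained in [Z]. *)
Lemma small_of_not_scrP' (Z : set Qpos) (C0 : nat -> set (seq bool)) :
  (forall n w, C0 n w -> exists2 x : Qpos, Z x & \val x = node (block n) w) ->
  ~ scrP' Z -> small C0.
Proof.
move=> CZ nZ [C [CC0 cC uC]]; apply: nZ.
pose D := \bigcup_n node (block n) @` C n.
have cD : crowded D.
  move=> b; apply: crowded_bigcup => n.
  exact: image_node_crowded (block_crowded (n:=n)) (block_nonempty n) (cC n b).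
have uD : unbounded_rat D.
  move=> r; have [n nr [w Cw]] := uC (Num.truncn r).+1.
  exists (node (block n) w); first by exists n => //; exists w.
  have /andP[nx _] := node_in w (@block_crowded n) (block_nonempty n).
  apply: lt_trans nx; apply: lt_le_trans (truncnS_gt _) _.
  by rewrite ler_nat.
have [X [XD clX cX uX]] := closed_crowded_subset cD uD.
have XZ x : X x -> exists2 y : Qpos, Z y & \val y = x.
  move=> /XD[n _ [w /CC0/CZ[y Zy yx] wx]]; exists y => //.
  by rewrite yx.
exists [set x : Qpos | X (\val x)]; last first.
  by move=> x /= /XZ[y Zy /val_inj <-].
split; first split; first exact: closed_val_preimage.
  move=> x Xx e e0.
  have [y Xy [yx ye]] := cX false _ Xx _ e0; have [z Xz [zx ze]] := cX true _ Xx _ e0.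
  have [y' _ y'y] := XZ _ Xy; have [z' _ z'z] := XZ _ Xz.
  exists y', z'; move: yx ye zx ze; rewrite /side /= !ltr_distl.
  move=> yx /andP[ye _] zx /andP[_ ze].
  by rewrite /= y'y z'z.
by move=> r; have [x Xx rx] := uX r; have [y _ yx] := XZ _ Xx; exists y; rewrite ?yx //= yx.
Qed.

(** * Guessing sets of words at stages below omega_1 *)

Section Guessing.
Context {d : Order.disp_t} {W : orderType d}.
Variable eps : W -> nat -> W.

Definition segment (a : W) (k : nat) : seq W := mkseq (eps a) k.

Lemma take_segment a i j : (i <= j)%N -> take i (segment a j) = segment a i.
Proof. by move=> ij; rewrite /segment /mkseq -map_take take_iota (minn_idPl ij). Qed.

(* The part of the information [T] that is visible below [a]. *)
Definition trace (T : seq W -> nat -> set (seq bool)) (a : W) (n : nat) : set (seq bool) :=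
  [set w | exists k, T (segment a k) n w].

(** [T] takes the place of the function [f] of the diamond, and [R] is a set of stages reserved for
    one task. *)
Definition guessing (G : W -> nat -> set (seq bool)) (R : set W) :=
  forall T, stat [set a | R a /\ tree_reaps (G a) (trace T a)].

Hypothesis hW : is_omega1 W.
Hypothesis epsP : forall a, (exists b, (b < a)%O) ->
  (forall k, (eps a k < a)%O) /\ (forall b, (b < a)%O -> exists k, eps a k = b).

Lemma closed_under_nonmin c (a : W) : closed_under c a -> exists b, (b < a)%O.
Proof. by move=> ca; exists (c 0%N [::]); exact: ca. Qed.

Lemma segment_below a k : (exists b, (b < a)%O) ->
  all (fun x : W => (x < a)%O) (segment a k).
Proof. by move=> /epsP[ea _]; apply/allP => x /mapP[i _ ->]. Qed.

Definition pair_closure (c c' : nat -> seq W -> W) k s :=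
  if odd k then c k./2 s else c' k./2 s.

Lemma closed_under_pair c c' a : closed_under (pair_closure c c') a ->
  closed_under c a /\ closed_under c' a.
Proof.
move=> ca; split=> k s sa.
  by have := ca k.*2.+1 s sa; rewrite /pair_closure /= odd_double uphalf_double.
by have := ca k.*2 s sa; rewrite /pair_closure odd_double doubleK.
Qed.

(** [T] is coded by a function [f] on ordinals, and [F] decodes its trace from the restriction of
    [f]. Closure of [a] under [code] puts the codes of lists below [a] below [a]; injectivity of the
    codes and of [node] prevents spurious elements. *)
Lemma diamond_guessing : diamond_rP W -> exists G,
  (forall a, blocks_crowded (G a) /\ blocks_unbounded (G a)) /\ guessing G setT.
Proof.
move=> dia; have [code codeP] := seq_code hW.
pose pos s (n : nat) (w : seq bool) := code s (pickle (n, w)).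
have posP s t n m w u : pos s n w = pos t m u -> [/\ s = t, n = m & w = u].
  by move=> /codeP[-> /(pcan_inj pickleK)[-> ->]].
pose F (a : W) (s : two_to a) : set Qpos := [set x | exists n w k (p : below a),
  [/\ \val x = node (block n) w, sval p = pos (segment a k) n w & s p]].
have [|g gB gS] := dia F.
  (* Membership of [q] is witnessed by the value of [s] at the single coordinate [p], an open
     condition. *)
  move=> a; apply: borel_fun_chi => q; rewrite openE => s [n [w [k [p [qw pk sp]]]]].
  have : nbhs (s : {ptws below a -> bool}) (proj p @^-1` [set true]).
    apply: proj_continuous; apply: open_nbhs_nbhs; split; first exact: discrete_open.
    by rewrite /proj /= sp.
  by move=> nb; apply: filterS nb => t /= tp; exists n, w, k, p; split=> //; exact: tp.
pose S a := [set r : rat | exists2 x : Qpos, g a x & \val x = r].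
have cS a : crowded (S a).
  move=> b r [x gx <-] e e0; have [[_ tc] _] := gB a.
  have [y [z [gy gz ye yx [xz ze]]]] := tc x gx e e0.
  case: b; [exists (\val z); first by exists z|exists (\val y); first by exists y].
    by split; [exact: xz|rewrite ltr_distl; apply/andP; split; lra].
  by split; [exact: yx|rewrite ltr_distl; apply/andP; split; lra].
have uS a : unbounded_rat (S a).
  by move=> r; have [_ /(_ r)[x gx rx]] := gB a; exists (\val x) => //; exists x.
exists (fun a n => [set w | S a (node (block n) w)]); split=> [a|T c].
  split; first exact: blocks_preimage_crowded.
  move=> m; have [n [z [mn Sz Bz]]] := crowded_meets_block m%:R (@cS a) (@uS a).
  exists n; first by move: mn; rewrite ltr_nat => /ltnW.
  by have [w wz] := node_surj (@block_crowded n) Bz; exists w; rewrite /= wz.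
pose f p := `[< exists s n w, p = pos s n w /\ T s n w >].
have [a [ra /closed_under_pair[cca cpa]]] :=
  stationary_stat hW (gS f) (pair_closure c (fun k s => code s k)).
exists a; split=> //; split=> //.
have a_nm := closed_under_nonmin cca.
have FE (x : Qpos) n w : \val x = node (block n) w ->
    F a (restr f a) x <-> trace T a n w.
  move=> xw; split.
    move=> [m [u [k [p [xu pk /asboolP[s [n' [w' [+ Tw]]]]]]]]].
    rewrite pk => /posP[ks mn uw]; exists k; rewrite ks; subst m u.
    have nB l v := node_in v (@block_crowded l) (block_nonempty l).
    have e : n = n'.
      by apply: (@block_inj _ _ (\val x)); [rewrite xw|rewrite xu]; exact: nB.
    subst n'; suff -> : w = w' by [].
    by apply: (node_inj (@block_crowded n) (block_nonempty n)); rewrite -xw.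
  move=> [k Tw].
  have pa : (pos (segment a k) n w < a)%O by apply: cpa; exact: segment_below.
  exists n, w, k, (exist (fun b : W => is_true (b < a)%O) _ pa); split=> //.
  by rewrite /restr /=; apply/asboolP; exists (segment a k), n, w.
case: ra => nP; [left|right]; apply: small_of_not_scrP' nP => n w /= [[x gx xw]] Tw;
  exists x => //; split=> //.
  by move=> /(FE _ _ _ xw).
by apply/(FE _ _ _ xw).
Qed.

(* Otherwise, for some [b], each of the countably many sets in a row of this
   Ulam matrix fails for some [Tc k]; the label [k] of [a] can be read off the
   initial segments of [eps a], so one [T] can combine all the [Tc k]. *)
Lemma guessing_roles (G : W -> nat -> set (seq bool)) : guessing G setT ->
  exists R : 'I_3 -> set W, (forall i, guessing G (R i)) /\
    forall i j a, R i a -> R j a -> i = j.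
Proof.
move=> gG; pose R b k := [set a : W | [/\ (b < a)%O, eps a k = b & b \notin segment a k]].
have role b : exists k, guessing G (R b k).
  apply: contrapT => /forallNP nG.
  have /choice[Tc TcP] : forall k, exists Tc : (seq W -> nat -> set (seq bool)) *
      (nat -> seq W -> W), forall a, closed_under Tc.2 a -> R b k a ->
        ~ tree_reaps (G a) (trace Tc.1 a).
    move=> k; have /existsNP[T /existsNP[c cP]] := nG k.
    by exists (T, c) => a ca Ra ra; apply: cP; exists a.
  (* [T] waits until [b] appears in the list, takes its first position as the label [k], and then
     consults [Tc k] on initial segments. *)
  pose T s n w := b \in s /\ exists i, (Tc (index b s)).1 (take i s) n w.
  pose c' k s := if unpickle k is Some kl then (Tc kl.1).2 kl.2 s else b.
  have [a [[_ ra] /closed_under_pair[/(_ 0%N [::] isT) ba ca]]] :=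
    gG T (pair_closure (fun _ _ => b) c').
  have [_ /(_ b ba) bk] := epsP (ex_intro _ b ba).
  have exk : exists k, eps a k == b by have [k <-] := bk; exists k.
  have [k /eqP kb kmin] := ex_minnP exk.
  have bNk : b \notin segment a k.
    apply/mapP => -[i]; rewrite mem_iota /= => ik /esym/eqP/kmin; lia.
  apply: (TcP k a); first by move=> l s sa; have := ca (pickle (k, l)) s sa;
    rewrite /c' pickleK.
    by split.
  have indexS j : b \in segment a j -> index b (segment a j) = k.
    move=> bj; have kj : (k < j)%N.
      rewrite ltnNge; apply/negP => jk; move/negP: bNk; apply.
      by move: bj; rewrite -(take_segment _ jk) => /mem_take.
    rewrite -(cat_take_drop k.+1 (segment a j)) take_segment// index_cat.
    rewrite /segment mkseqS mem_rcons kb mem_head -cats1 index_cat (negbTE bNk) /=.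
    by rewrite eqxx addn0 size_mkseq.
  suff -> : trace (Tc k).1 a = trace T a by [].
  apply: funext => n; apply/seteqP; split=> w /=.
    move=> [i Tw]; exists (k + i).+1.
    have bS : b \in segment a (k + i).+1.
      by apply/mapP; exists k; rewrite ?kb // mem_iota /=; lia.
    by split=> //; exists i; rewrite indexS // take_segment //; lia.
  move=> [j [bj [i]]]; rewrite (indexS _ bj) => Tw.
  have [ij|ji] := leqP i j; first by exists i; move: Tw; rewrite take_segment.
  by exists j; move: Tw; rewrite take_oversize // size_mkseq ltnW.
have [k kP] := choice role.
(* Some label [n] serves uncountably many [b]; the sets [R b n] for distinct [b] are disjoint
   because [eps a n] determines [b]. *)
have [n nN] : exists n, ~ countable [set b | k b = n].
  apply: contrapT => /forallNP h; case: (hW) => _ nc _; apply: nc.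
  rewrite (_ : setT = \bigcup_n [set b | k b = n]).
    by apply: bigcup_countable => // n _; apply: contrapT; exact: h.
  by apply/seteqP; split=> // b _; exists (k b).
have pick (s : seq W) : exists b, k b = n /\ b \notin s.
  apply: contrapT => /forallNP h; apply: nN.
  apply: (sub_countable (B := [set` s])); last exact/finite_set_countable/finite_seq.
  apply: subset_card_le => b /= kb; apply: contrapT => /negP bs.
  by apply: (h b).
have [b0 [k0 _]] := pick [::]; have [b1 [k1 n1]] := pick [:: b0].
have [b2 [k2 n2]] := pick [:: b0; b1].
pose B (i : 'I_3) := nth b0 [:: b0; b1; b2] i.
have kB i : k (B i) = n by case: i => -[|[|[]]].
exists (fun i => R (B i) n); split=> [i|i j a [_ ei _] [_ ej _]].
  by rewrite -(kB i); exact: kP.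
have : B i = B j by rewrite -ei -ej.
have uB : uniq [:: b0; b1; b2].
  by rewrite /= andbT andbC; move: n1 n2; rewrite !inE !negb_or => h1 /andP[h2 h3];
    rewrite (eq_sym b0) h1 (eq_sym b0) h2 eq_sym h3.
by move=> /eqP; rewrite nth_uniq // => /eqP/val_inj.
Qed.

(* If [G] has a word of length at most [q] in a block, then the words of [G]
   longer than [q] take both letters at position [q]. *)
Lemma split_long_words (G : nat -> set (seq bool)) (q : nat -> nat) :
  blocks_crowded G ->
  tree_reaps G (fun n => [set w | (q n < size w)%N /\ nth false w (q n)]) ->
  exists N, forall n, (N <= n)%N -> forall w, G n w -> (q n < size w)%N.
Proof.
move=> cG rG; apply: contrapT => /forallNP nN.
pose C b n := [set w | G n w /\ (q n < size w)%N && (nth false w (q n) == b)].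
have cC b : blocks_crowded (C b).
  move=> n c w [Gw /andP[qw wb]] j; have [v Gv] := cG n c w Gw j.
  exists v; split=> //; rewrite /child size_cat nth_cat qw (eqP wb) eqxx andbT.
  exact: ltn_addr.
have uC b : blocks_unbounded (C b).
  move=> m; have /existsNP[n /not_implyP[mn /existsNP[w /not_implyP[Gw /negP]]]] := nN m.
  rewrite -leqNgt => wq; exists n => //.
  have [wqe|wql] := eqVneq (size w) (q n).
    have [v Gv] := cG n b w Gw 0%N; exists (child b w 0 v); split=> //.
    by rewrite /child size_cat nth_cat wqe ltnn subnn /= eqxx andbT; lia.
  (* The run of [q n] letters [b] after the letter [~~ b] covers position [q n]. *)
  have [v Gv] := cG n (~~ b) w Gw (q n); exists (child (~~ b) w (q n) v); split=> //.
  have wlt : (size w < q n)%N by rewrite ltn_neqAle wql.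
  rewrite /child size_cat nth_cat [(q n < size w)%N]ltnNge wq /= negbK.
  have -> : (q n - size w = (q n - size w).-1.+1)%N by lia.
  rewrite /= nth_cat size_nseq nth_nseq.
  have -> : ((q n - size w).-1 < q n)%N by lia.
  by rewrite size_cat size_nseq eqxx andbT; lia.
case: rG => sm; apply: sm.
  exists (C false); split=> // n w [Gw /andP[qw /eqP wb]].
  by split=> // -[_]; rewrite wb.
by exists (C true); split=> // n w [Gw /andP[qw /eqP wb]].
Qed.

(** [psi a n] is the length of a word of [G a] in some block from [n] on. The guessed words carry
    [true] at position [q n], the segment length by which [T 0], ..., [T n] have succeeded;
    [split_long_words] then makes the words of late blocks longer than [q]. *)
Lemma guessing_dominates (G : W -> nat -> set (seq bool)) (R : set W) :
  (forall a, blocks_crowded (G a) /\ blocks_unbounded (G a)) -> guessing G R ->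
  exists psi : W -> nat -> nat, forall (T : nat -> seq W -> Prop) c,
    (forall a, closed_under c a -> forall n, exists m, T n (segment a m)) ->
    exists a, [/\ R a, closed_under c a &
      exists N, forall n, (N <= n)%N -> exists2 m, (m <= psi a n)%N & T n (segment a m)].
Proof.
move=> Gcu gR.
have /choice[psi psiP] : forall a, exists p : nat -> nat, forall n,
    exists2 n', (n <= n')%N & exists2 w, G a n' w & size w = p n.
  move=> a; suff /choice[p pP] : forall n, exists p, exists2 n', (n <= n')%N &
      exists2 w, G a n' w & size w = p by exists p.
  move=> n; have [_ /(_ n)[n' nn' [w Gw]]] := Gcu a.
  by exists (size w), n' => //; exists w.
exists psi => T c cT.
(* All [i] up to [n] are required because [psi a n] comes from a block [n'] that may exceed [n]. *)
pose U n s := forall i, (i <= n)%N -> exists2 m, (m <= size s)%N & T i (take m s).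
pose Th s n (w : seq bool) := exists q, [/\ (q <= size s)%N, U n (take q s),
  forall q', (q' < q)%N -> ~ U n (take q' s), (q < size w)%N & nth false w q].
have [a [[Ra ra] ca]] := gR Th c.
exists a; split=> //.
have UE n q : U n (segment a q) <->
    forall i, (i <= n)%N -> exists2 m, (m <= q)%N & T i (segment a m).
  split=> h i /h[m mq Tm]; exists m; rewrite ?size_mkseq // ?take_segment //.
    by move: mq; rewrite size_mkseq.
  by rewrite size_mkseq in mq; rewrite take_segment in Tm.
have exU n : exists q, `[< U n (segment a q) >].
  have [m mP] := choice (cT a ca).
  exists (\max_(i < n.+1) m i); apply/asboolP/UE => i ni.
  by exists (m i) => //; exact: (@leq_bigmax _ (fun i : 'I_n.+1 => m i) (Ordinal (ni : (i < n.+1)%N))).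
pose q n := ex_minn (exU n).
have qU n : U n (segment a (q n)) by rewrite /q; case: ex_minnP => k /asboolP.
have qmin n k : U n (segment a k) -> (q n <= k)%N.
  by move=> Uk; rewrite /q; case: ex_minnP => l _; apply; apply/asboolP.
have [|N NP] := @split_long_words (G a) q (Gcu a).1.
  suff -> : (fun n => [set w | (q n < size w)%N /\ nth false w (q n)]) = trace Th a by [].
  apply: funext => n; apply/seteqP; split=> w /=.
    move=> [qw wq]; exists (q n), (q n); split=> //.
    - by rewrite size_mkseq.
    - by rewrite take_segment.
    - by move=> q' q'q; rewrite take_segment ?(ltnW q'q)// => /qmin; rewrite leqNgt q'q.
  move=> [k [p []]]; rewrite size_mkseq => pk; rewrite take_segment // => Up pmin pw wp.
  suff -> : q n = p by [].
  apply/eqP; rewrite eqn_leq qmin //= leqNgt; apply/negP => qp.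
  by apply: (pmin _ qp); rewrite take_segment //; apply: leq_trans (ltnW qp) pk.
exists N => n Nn; have [n' nn' [w Gw wn]] := psiP a n.
have := NP n' (leq_trans Nn nn') w Gw; rewrite wn => qn'.
have [m mq Tm] := (UE n' _).1 (qU n') n nn'.
by exists m => //; apply: leq_trans mq (ltnW qn').
Qed.

End Guessing.

(** * Towers *)

Definition meet (l : seq (set rat)) : set rat := foldr setI setT l.

Definition hits (l : seq (set rat)) (n : nat) :=
  crowded (meet l `&` block n) /\ (meet l `&` block n) !=set0.

Definition tame (l : seq (set rat)) := forall m, exists2 n, (m <= n)%N & hits l n.

(* The block assigned to a list depends on its prefixes, so that the blocks
   assigned to the prefixes of a sequence increase strictly. *)
Fixpoint block_index (k : nat) (l : seq (set rat)) : nat :=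
  if k is k'.+1 then
    xget 0%N [set n | (block_index k' l < n)%N /\ hits (take k l) n]
  else 0%N.

(** It is computed from a finite list alone, so sets of words attached to it can be described
    through the lists [segment eps a k]. *)
Definition piece (l : seq (set rat)) : set rat := meet l `&` block (block_index (size l) l).

Lemma block_index_take k j l : (k <= j)%N -> block_index k (take j l) = block_index k l.
Proof.
elim: k => //= k IH kj; rewrite IH ?(ltnW kj)//.
by rewrite take_takel.
Qed.

Lemma meet_mkseq (f : nat -> set rat) k n : (k < n)%N -> meet (mkseq f n) `<=` f k.
Proof.
elim: n => // n IH; rewrite ltnS leq_eqVlt mkseqS -cats1 /meet foldr_cat => kn x.
have aux (l : seq (set rat)) (A : set rat) : foldr setI A l x -> foldr setI setT l x /\ A x.
  by elim: l => //= B l IHl [Bx /IHl[]].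
by move=> /aux[mx [fx _]]; case/orP: kn => [/eqP ->//|/IH]; exact.
Qed.

(** * Diagonal sets along a sequence of sets *)

Section Pieces.
Variable f : nat -> set rat.
Hypothesis tf : forall k, tame (mkseq f k).

Definition index_at n := block_index n.+1 (mkseq f n.+1).

Lemma index_atS n : (block_index n (mkseq f n) < index_at n)%N /\ hits (mkseq f n.+1) (index_at n).
Proof.
have e : block_index n (mkseq f n.+1) = block_index n (mkseq f n).
  rewrite -(block_index_take (mkseq f n.+1) (leqnn n)) -map_take take_iota.
  by rewrite (minn_idPl (leqnSn n)).
have [m mn hm] := tf n.+1 (block_index n (mkseq f n)).+1.
rewrite /index_at /= e -/(mkseq f n.+1) take_oversize; last by rewrite size_map size_iota.
by apply: (xgetPex 0%N (P := [set k | (block_index n (mkseq f n) < k)%N /\ hits _ k])); exists m.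
Qed.

Lemma index_at_lt m n : (m < n)%N -> (index_at m < index_at n)%N.
Proof.
elim: n => // n IH; rewrite ltnS leq_eqVlt => /orP[/eqP ->|/IH mn].
  exact: (index_atS n.+1).1.
exact: ltn_trans mn (index_atS n.+1).1.
Qed.

Lemma leq_index_at n : (n <= index_at n)%N.
Proof. by elim: n => // n IH; exact: leq_ltn_trans IH (index_at_lt (leqnn _)). Qed.

Lemma piece_mkseq n : piece (mkseq f n.+1) = meet (mkseq f n.+1) `&` block (index_at n).
Proof. by rewrite /piece size_mkseq. Qed.

Lemma piece_crowded n : crowded (piece (mkseq f n.+1)).
Proof. by rewrite piece_mkseq; exact: (index_atS n).2.1. Qed.

Lemma piece_nonempty n : piece (mkseq f n.+1) !=set0.
Proof. by rewrite piece_mkseq; exact: (index_atS n).2.2. Qed.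

Lemma piece_block n x : piece (mkseq f n.+1) x -> block (index_at n) x.
Proof. by rewrite piece_mkseq => -[]. Qed.

Lemma node_block n w : block (index_at n) (node (piece (mkseq f n.+1)) w).
Proof. exact/piece_block/(node_in _ (@piece_crowded n) (@piece_nonempty n)). Qed.

(** Almost contained in every [f k], since the [n]-th piece lies in [f 0], ..., [f n]. *)
Definition spread (V : nat -> set (seq bool)) : set rat :=
  \bigcup_n node (piece (mkseq f n.+1)) @` V n.

Lemma spread_crowded V : blocks_crowded V -> crowded (spread V).
Proof.
move=> cV b; apply: crowded_bigcup => n.
exact: image_node_crowded (@piece_crowded n) (@piece_nonempty n) (cV n b).
Qed.

Lemma spread_unbounded V : blocks_unbounded V -> unbounded_rat (spread V).
Proof.
move=> uV r; have [n rn [w Vw]] := uV (Num.truncn r).+1.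
exists (node (piece (mkseq f n.+1)) w); first by exists n => //; exists w.
have /andP[nx _] := node_block n w.
apply: lt_trans nx; apply: lt_le_trans (truncnS_gt _) _.
by rewrite ler_nat (leq_trans rn) // leq_index_at.
Qed.

Lemma spread_above V n x : spread V x -> (index_at n)%:R < x ->
  exists m w, [/\ (n <= m)%N, V m w & x = node (piece (mkseq f m.+1)) w].
Proof.
move=> [m _ [w Vw <-]] nx; exists m, w; split=> //; rewrite leqNgt; apply/negP => mn.
have /andP[_] := node_block m w; rewrite ltNge => /negP; apply.
by apply: le_trans (ltW nx); rewrite ler_nat index_at_lt.
Qed.

Lemma spread_pullback V C : crowded C -> unbounded_rat C -> C `<=` spread V ->
  let C' n := [set w | V n w /\ C (node (piece (mkseq f n.+1)) w)] in
  blocks_crowded C' /\ blocks_unbounded C'.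
Proof.
move=> cC uC CV; split=> [n b w [Vw Cw] j|m].
  have cb : crowded_on b (C `&` block (index_at n)) by exact: crowded_on_between.
  have [||v [Vv [Cv _]]] := @preimage_node_crowded _ b (V n) _
      (@piece_crowded n) (@piece_nonempty n) cb _ w _ j.
  (* Different pieces lie in different blocks, so a point of [C] in this block comes from [V n]. *)
  - move=> x [/CV[n' _ [w' Vw' xw']] Bx]; suff -> : n = n' by exists w'.
    have := @block_inj (index_at n) (index_at n') x Bx.
    rewrite -xw' => /(_ (node_block _ _)).
    by case: (ltngtP n n') => // /index_at_lt + e; rewrite e ltnn.
  - by split=> //; split=> //; exact: node_block.
  - by exists v.
have [x Cx mx] := uC (index_at m)%:R.
have [n [w [mn Vw xw]]] := spread_above (CV _ Cx) mx.
by exists n => //; exists w; split=> //; rewrite -xw.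
Qed.

End Pieces.

Definition scanty (S : set rat) :=
  ~ exists C, [/\ C `<=` S, crowded C & unbounded_rat C].

Definition almost_sub (A B : set rat) := exists r, forall x, A x -> r < x -> B x.

(** * Almost decreasing towers of length omega_1 *)

Section Tower.
Context {d : Order.disp_t} {W : orderType d}.
Variable eps : W -> nat -> W.
Hypothesis hW : is_omega1 W.
Hypothesis epsP : forall a, (exists b, (b < a)%O) ->
  (forall k, (eps a k < a)%O) /\ (forall b, (b < a)%O -> exists k, eps a k = b).

(** Beyond some rational the intersection agrees with the set of greatest index in the list, which
    is crowded and meets infinitely many blocks. *)
Lemma tame_map (h : W -> set rat) (s : seq W) :
  (forall b, b \in s -> crowded (h b) /\ unbounded_rat (h b)) ->
  (forall b c, b \in s -> c \in s -> (b < c)%O -> almost_sub (h c) (h b)) ->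
  tame (map h s).
Proof.
move=> hcu hsub.
suff [Y [cY uY [r rY]]] : exists Y, [/\ crowded Y, unbounded_rat Y &
    exists r, forall x, r < x -> meet (map h s) x <-> Y x].
  move=> m; have [n [z [mn Yz Bz]]] := crowded_meets_block (Num.max r m%:R) cY uY.
  move: mn; rewrite gt_max ltr_nat => /andP[rn /ltnW mn]; exists n => //.
  have e : meet (map h s) `&` block n = Y `&` block n.
    by apply/seteqP; split=> x [+ Bx]; (have /andP[nx _] := Bx); move=> /(rY x (lt_trans rn nx)).
  by rewrite /hits e; split; [exact: crowded_between|exists z].
have uT : unbounded_rat setT by move=> r; exists (r + 1) => //; rewrite ltrDl.
have [->|] := eqVneq s [::]; first by exists setT; split=> //; [exact: setT_crowded|exists 0].
suff H : s != [::] -> exists2 b, b \in s & exists r, forall x, r < x ->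
    meet (map h s) x <-> h b x.
  by move=> /H[b bs br]; have [cb ub] := hcu b bs; exists (h b).
elim: s hcu hsub => //= c s IH hcu hsub _.
have [s0|sn0] := eqVneq s [::].
  subst s; exists c; rewrite ?mem_head //; exists 0 => x _ /=.
  by split=> [[]|].
have [b bs [r rb]] : exists2 b, b \in s & exists r, forall x, r < x ->
    meet (map h s) x <-> h b x.
  apply: IH => // [b bs|b e bs es]; first by apply: hcu; rewrite inE bs orbT.
  by apply: hsub; rewrite inE ?bs ?es orbT.
case: (ltgtP b c) => [bc|cb|<-].
- have [|r' rc] := hsub b c _ (mem_head _ _) bc; first by rewrite inE bs orbT.
  exists c; rewrite ?mem_head //; exists (Num.max r r') => x; rewrite gt_max => /andP[rx rx'].
  by split=> [[]//|cx]; split=> //; apply/(rb x rx)/rc.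
- have [|r' rc] := hsub c b (mem_head _ _) _ cb; first by rewrite inE bs orbT.
  exists b; rewrite ?inE ?bs ?orbT //; exists (Num.max r r') => x.
  rewrite gt_max => /andP[rx rx'].
  by split=> [[_ /(rb x rx)]//|bx]; split; [exact: rc|apply/(rb x rx)].
- exists b; rewrite ?mem_head //; exists r => x rx.
  by split=> [[]//|bx]; split=> //; apply/(rb x rx).
Qed.

Lemma map_segment (X : W -> set rat) a k : map X (segment eps a k) = mkseq (X \o eps a) k.
Proof. by rewrite /segment /mkseq -map_comp. Qed.

(** Stage [a] arranges the earlier sets in an omega-sequence by [eps a] and takes a closed crowded
    unbounded subset of the spread of [V a] along it. [V a] carries the task of the stage. *)
Lemma tower (V : W -> nat -> set (seq bool)) :
  (forall a, blocks_crowded (V a) /\ blocks_unbounded (V a)) ->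
  exists X : W -> set rat,
  [/\ forall a, [/\ closed (X a : set rat^o), crowded (X a) & unbounded_rat (X a)],
      forall a b, (b < a)%O -> almost_sub (X a) (X b),
      forall s, tame (map X s) &
      forall a, (exists b, (b < a)%O) -> X a `<=` spread (X \o eps a) (V a)].
Proof.
move=> Vcu.
pose good a (h : W -> set rat) (Y : set rat) :=
  [/\ Y `<=` spread (h \o eps a) (V a), closed (Y : set rat^o), crowded Y & unbounded_rat Y].
have [X XE] := omega1_rec hW setT (fun a h => xget setT (good a h)).
pose h a b := if (b < a)%O then X b else setT.
have hE a : (exists b, (b < a)%O) -> forall k, h a (eps a k) = X (eps a k).
  by move=> /epsP[ea _] k; rewrite /h ea.
have main a : [/\ good a (h a) (X a) & forall b, (b < a)%O -> almost_sub (X a) (X b)].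
  elim/(omega1_ind hW): a => a IH.
  have tm k : tame (mkseq (h a \o eps a) k).
    rewrite -map_segment; apply: tame_map => [b _|b c bs cs bc].
      rewrite /h; case: ifP => [/IH[[_ _ cb ub] _]//|_].
      split; first exact: setT_crowded.
      by move=> r; exists (r + 1) => //; rewrite ltrDl.
    rewrite /h; have [ca|nca] := boolP (c < a)%O.
      by rewrite (lt_trans bc ca); have [_] := IH c ca; exact.
    (* For minimal [a] the list may contain ordinals not below [a], but then all values of [h a] are
       [setT]. *)
    have [nm|nnm] := pselect (exists b, (b < a)%O).
      by have /allP/(_ c cs) := segment_below epsP k nm; rewrite (negbTE nca).
    rewrite ifF; first by exists 0.
    by apply/negP => ba; apply: nnm; exists b.
  have gX : good a (h a) (X a).
    rewrite [X a]XE; apply: xgetPex; have [cV uV] := Vcu a.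
    exact: closed_crowded_subset (spread_crowded tm cV) (spread_unbounded tm uV).
  split=> // b ba; have nm : exists b, (b < a)%O by exists b.
  have [_ /(_ b ba)[k kb]] := epsP nm; case: gX => XV _ _ _.
  exists (index_at (h a \o eps a) k)%:R => x /XV xV kx.
  have [n [w [kn _ ->]]] := spread_above tm xV kx.
  have [] := node_in w (@piece_crowded _ tm n) (@piece_nonempty _ tm n).
  by move=> /(meet_mkseq (leq_ltn_trans kn (ltnSn n))) /=; rewrite kb /h ba.
exists X; split=> [a|a b ba|s|a nm].
- by have [[]] := main a.
- by have [_] := main a; exact.
- apply: tame_map => [b _|b c _ _ bc]; first by have [[]] := main b.
  by have [_] := main c; exact.
have [[XV _ _ _] _] := main a; rewrite (_ : X \o eps a = h a \o eps a) //.
by apply: funext => k /=; rewrite hE.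
Qed.

(** [T] pulls [A] back to words along the pieces. By [spread_pullback], crowded unbounded subsets of
    [X a] yield such families of words in [G a], and reaping excludes these on one side of [A]. *)
Lemma tower_reaps (V G : W -> nat -> set (seq bool)) (R : set W) (X : W -> set rat) :
  (forall s, tame (map X s)) ->
  (forall a, (exists b, (b < a)%O) -> X a `<=` spread (X \o eps a) (V a)) ->
  guessing eps G R -> (forall a, R a -> V a = G a) ->
  forall A, exists a, scanty (X a `\` A) \/ scanty (X a `&` A).
Proof.
move=> tX XV gR VG A.
(* The condition on the size selects, for each [n], the one segment whose piece carries the words of
   [V a n]. *)
pose T (s : seq W) n (w : seq bool) := size s = n.+1 /\ A (node (piece (map X s)) w).
have [bnd _] := omega1_bound hW.
have [a [[Ra ra] ca]] := gR T (fun _ _ => bnd set0).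
have nm := closed_under_nonmin ca; exists a.
have ta k : tame (mkseq (X \o eps a) k) by rewrite -map_segment; exact: tX.
have TE n w : trace eps T a n w <-> A (node (piece (mkseq (X \o eps a) n.+1)) w).
  rewrite /trace /T /=; split=> [[k [+ +]]|Aw].
    by rewrite size_mkseq map_segment => ->.
  by exists n.+1; rewrite size_mkseq map_segment.
have pull (C : set rat) : C `<=` X a -> crowded C -> unbounded_rat C ->
    let C' n := [set w | G a n w /\ C (node (piece (mkseq (X \o eps a) n.+1)) w)] in
    blocks_crowded C' /\ blocks_unbounded C'.
  move=> CX cC uC; rewrite -VG //; apply: spread_pullback => //.
  exact: subset_trans CX (XV a nm).
case: ra => sm; [left|right] => -[C [CX cC uC]]; apply: sm.
  have CXa : C `<=` X a by move=> x /CX[].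
  have [cC' uC'] := pull C CXa cC uC; eexists; split; [|exact: cC'|exact: uC'].
  by move=> n w [Gw /CX[_ nA]]; split=> // /TE.
have CXa : C `<=` X a by move=> x /CX[].
have [cC' uC'] := pull C CXa cC uC; eexists; split; [|exact: cC'|exact: uC'].
by move=> n w [Gw /CX[_ Aw]]; split=> //; apply/TE.
Qed.

End Tower.

(** * P-points and avoidance *)

Definition eventually_in (A B : set nat) := exists m, forall j, (m <= j)%N -> A j -> B j.

Definition thin b (S : set (seq bool)) :=
  forall C, C `<=` S -> tree_crowded b C -> forall w, ~ C w.

Lemma child_cat b w j u v : child b w j u ++ v = child b w j (u ++ v).
Proof. by rewrite /child -catA /= -catA. Qed.

Lemma child_le b w j j' v : (j <= j')%N ->
  child b w j' v = child b w j (nseq (j' - j) (~~ b) ++ v).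
Proof. by move=> jj; rewrite /child -{1}(subnKC jj) nseqD -catA. Qed.

Section Ppoint.
Context {d : Order.disp_t} {W : orderType d}.
Variable eps : W -> nat -> W.
Hypothesis hW : is_omega1 W.
Hypothesis epsP : forall a, (exists b, (b < a)%O) ->
  (forall k, (eps a k < a)%O) /\ (forall b, (b < a)%O -> exists k, eps a k = b).

(** Modulo finite sets, a decreasing base of length omega_1 of a nonprincipal ultrafilter on the
    naturals. *)
Definition ppoint_base (E : W -> set nat) :=
  [/\ forall a b, (b < a)%O -> eventually_in (E a) (E b),
      forall a m, exists2 j, (m <= j)%N & E a j &
      forall B, exists a, eventually_in (E a) B \/ eventually_in (E a) (~` B)].

(** [E a] collects the blocks met by [X a] in a tower. To decide [B], [tower_reaps] is applied to
    the union of its blocks: a set containing the part of [X a] in infinitely many blocks met by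
    [X a] is not scanty. *)
Lemma ppoint_exists (G : W -> nat -> set (seq bool)) :
  (forall a, blocks_crowded (G a) /\ blocks_unbounded (G a)) ->
  guessing eps G setT -> exists E, ppoint_base E.
Proof.
move=> Gcu gG; have [X [Xg Xsub tX XV]] := tower hW epsP Gcu.
exists (fun a => [set n | (X a `&` block n) !=set0]); split=> [a b ba|a m|B].
- have [r rX] := Xsub _ _ ba; exists (Num.truncn r).+1 => j rj [x [Xx Bx]].
  exists x; split=> //; apply: rX => //; case/andP: Bx => jx _.
  by apply: lt_trans jx; apply: lt_le_trans (truncnS_gt _) _; rewrite ler_nat.
- have [_ cX uX] := Xg a; have [n [z [mn Xz Bz]]] := crowded_meets_block m%:R cX uX.
  by exists n; [move: mn; rewrite ltr_nat => /ltnW|exists z].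
- have scantyP a (P : set nat) (S : set rat) : scanty S ->
      (forall j, P j -> X a `&` block j `<=` S) ->
      eventually_in [set n | (X a `&` block n) !=set0] (~` P).
    move=> sS PS; apply: contrapT => /forallNP nE; apply: sS.
    exists (\bigcup_j [set x | P j /\ (X a `&` block j) x]); split=> [x [j _ [/PS]]|b|r].
    + exact.
    + apply: crowded_bigcup => j x [Pj XBx] e e0; have [_ cX _] := Xg a.
      by have [y XBy sy] := @crowded_on_between b _ j%:R j.+1%:R (cX b) x XBx e e0; exists y.
    + have /existsNP[j /not_implyP[rj /not_implyP[[x [Xx Bx]] /contrapT Pj]]] :=
        nE (Num.truncn r).+1.
      exists x; first by exists j.
      case/andP: Bx => jx _; apply: lt_trans jx; apply: lt_le_trans (truncnS_gt _) _.
      by rewrite ler_nat.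
  pose A := \bigcup_(j in B) block j.
  have [a [sA|sA]] := tower_reaps hW tX XV gG (fun _ _ => erefl) A; exists a.
    left; have [|m mP] := scantyP a (~` B) _ sA; last first.
      by exists m => j mj Ej; apply: contrapT; exact: mP.
    move=> j nBj x [Xx Bx]; split=> // -[j' Bj' /(block_inj Bx) jj'].
    by apply: nBj; rewrite jj'.
  right; apply: scantyP sA _ => j Bj x [Xx Bx]; split=> //.
  by exists j.
Qed.

Variable E : W -> set nat.
Hypothesis EP : ppoint_base E.

Definition large (B : set nat) := exists a, eventually_in (E a) B.

Lemma large_mono A B : A `<=` B -> large A -> large B.
Proof. by move=> AB [a [m mA]]; exists a, m => j mj Ej; exact/AB/mA. Qed.

Lemma large_nonempty B : large B -> B !=set0.
Proof.
by move=> [a [m mB]]; case: EP => _ /(_ a m)[j mj Ej] _; exists j; exact: mB.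
Qed.

(** The P-point property, from the uncountable cofinality of omega_1. *)
Lemma large_countable (X : countType) (B : X -> set nat) :
  (forall x, large (B x)) -> exists a, forall x, eventually_in (E a) (B x).
Proof.
move=> /choice[f fP]; case: EP => Edec _ _.
have [a aP] := @countable_bounded _ _ hW (range f)
  (sub_countable (card_image_le _ _) (countableP _)).
exists a => x; have [m mB] := fP x.
have [|m' mE] := Edec a (f x); first by apply: aP; exists x.
exists (maxn m m') => j; rewrite geq_max => /andP[mj mj'] Ej.
exact/mB/mE.
Qed.

Lemma largeI A B : large A -> large B -> large (A `&` B).
Proof.
move=> lA lB; have [|a aP] := @large_countable bool (fun x => if x then A else B).
  by case.
have [[m mA] [m' mB]] := (aP true, aP false); exists a, (maxn m m') => j.
by rewrite geq_max => /andP[mj mj'] Ej; split; [exact: mA|exact: mB].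
Qed.

Lemma large_tail m : large [set j | (m <= j)%N].
Proof.
by case: (EP) => _ _ /(_ setT)[a _]; exists a, m.
Qed.

Lemma largeN B : ~ large B -> large (~` B).
Proof.
by move=> nB; case: (EP) => _ _ /(_ B)[a [aB|aB]]; [case: nB|]; exists a.
Qed.

(* [M] is the largest set disjoint from [S] that contains almost all the
   [b]-children of each of its members.  The rank exists since a set avoiding
   [M], and almost all of whose [b]-children avoid [M], would yield a nonempty
   [b]-crowded subset of [S]. *)
Lemma escape b S : thin b S -> exists M (rk : seq bool -> W) x (H : seq bool -> nat),
  (forall w, M w -> ~ S w) /\ forall w j, (H w <= j)%N -> E x j ->
    (M w -> M (child b w j [::])) /\ (~ M w -> (rk (child b w j [::]) < rk w)%O).
Proof.
move=> thS; pose nxt (B : set (seq bool)) w := [set j | B (child b w j [::])].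
pose M := [set w | exists B : set (seq bool), [/\ B w, forall u, B u -> ~ S u &
  forall u, B u -> large (nxt B u)]].
have MS w : M w -> ~ S w by move=> [B [Bw BS _]]; exact: BS.
have Mnxt w : M w -> large (nxt M w).
  by move=> [B [Bw BS BL]]; apply: large_mono (BL w Bw) => j Bj; exists B.
have [||rk rkP] := @monotone_rank _ _ hW (seq bool : countType)
    (fun D => M `|` [set w | large (nxt D w)]).
- move=> A B AB w [Mw|lA]; [by left|right].
  by apply: large_mono lA => j; exact: AB.
- move=> D GD.
  have MD : M `<=` D by move=> w Mw; apply: GD; left.
  have DL w : ~ D w -> large (nxt (~` D) w).
    move=> nD; apply: large_mono (largeN (B := nxt D w) _) => // lD.
    by apply/nD/GD; right.
  (* If no word of [S] outside [D] extended the [j0]-th child of [c], the extensions outside [D]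
     would witness their own membership in [M] and so lie in [D]; yet some later child of [c] is
     such an extension. *)
  have cC : tree_crowded b (~` D `&` S).
    move=> c [nDc Sc] j0; apply: contrapT => /forallNP nC.
    pose B0 := [set u | ~ D u /\ exists v, u = child b c j0 v].
    have B0M : B0 `<=` M.
      move=> u0 B0u; exists B0; split=> // [u [nDu [v uv]] Su|u [nDu [v uv]]].
        by apply: (nC v); rewrite -uv.
      apply: large_mono (DL _ nDu) => j nDj; split=> //.
      by rewrite uv {1}/child child_cat; eexists.
    have [j [nDj jj]] := large_nonempty (largeI (DL c nDc) (large_tail j0)).
    apply/nDj/MD/B0M; split; first exact: nDj.
    by rewrite (child_le _ _ _ jj); eexists.
  have nDS w : ~ D w -> ~ S w by move=> nD Sw; exact: (thS _ (@subIsetr _ _ _) cC w).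
  by move=> w; apply: contrapT => nD; apply/nD/MD; exists (~` D).

pose B w := [set j | (M w -> M (child b w j [::])) /\
  (~ M w -> (rk (child b w j [::]) < rk w)%O)].
have [|x xP] := @large_countable (seq bool : countType) B.
  move=> w; have [Mw|nMw] := pselect (M w).
    by apply: large_mono (Mnxt w Mw) => j Mj; split.
  by case: (rkP w) => // rw; apply: large_mono rw => j rj; split.
have [H HP] := choice xP.
by exists M, rk, x, H; split=> // w j Hj Ej; exact: HP.
Qed.

(** A property holds throughout once it holds at [r] and at all values of [f] and passes to [ok]
    children; the two rules for children give crowdedness on both sides. *)
Inductive grown (b : bool) (r : seq bool) (ok : seq bool -> nat -> Prop)
    (f : seq bool -> seq bool) : set (seq bool) :=
| grown_root : grown b r ok f r
| grown_step w j : grown b r ok f w -> ok w j -> grown b r ok f (child b w j [::])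
| grown_back w j : grown b r ok f w -> grown b r ok f (f (child (~~ b) w j [::])).

Lemma grown_crowded b r ok f :
  (forall w m, exists2 j, (m <= j)%N & ok w j) ->
  (forall u, exists v, f u = u ++ v) ->
  forall c, tree_crowded c (grown b r ok f).
Proof.
move=> okP fP c w gw j; have [->|cb] := eqVneq c b.
  have [j' jj' okj'] := okP w j; exists (nseq (j' - j) (~~ b) ++ [::]).
  by rewrite -child_le //; exact: grown_step.
have -> : c = ~~ b by move: cb; case: (c); case: (b).
have [v fv] := fP (child (~~ b) w j [::]); exists v.
by rewrite -[v]cat0s -child_cat -fv; exact: grown_back.
Qed.

(* Following [b]-children whose indices are large and lie in [E a] leads into the
   set [M] of [escape].  Only finitely many candidates are known for the rank of
   each point on this path, so [bounded_descent] bounds its length without any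
   knowledge of [N]; a point on side [~~ b] is replaced by the end of its path. *)
Lemma avoidance b (G : W -> nat -> set (seq bool)) (R : set W) :
  (forall a, blocks_crowded (G a) /\ blocks_unbounded (G a)) -> guessing eps G R ->
  exists Z : W -> nat -> set (seq bool),
    (forall a, blocks_crowded (Z a) /\ blocks_unbounded (Z a)) /\
    forall N : seq W -> set (seq bool), (forall s, thin b (N s)) ->
      exists a, [/\ R a, exists c, (c < a)%O & exists n0, forall n, (n0 <= n)%N ->
        forall w, Z a n w -> ~ N (segment eps a n.+1) w].
Proof.
move=> Gcu gR; have [psi psiP] := guessing_dominates Gcu gR.
have [Esub Einf _] := EP.
(* Beyond this number, [E a] is contained in [E c] for every listed candidate [c] for the unknown
   index supplied by [escape]. *)
have /choice[kap kapP] : forall ak : W * nat, exists m, forall c,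
    c \in segment eps ak.1 ak.2 -> (c < ak.1)%O ->
    forall j, (m <= j)%N -> E ak.1 j -> E c j.
  move=> [a k] /=; elim: (segment eps a k) => [|c s [m IH]]; first by exists 0%N.
  have [ca|nca] := boolP (c < a)%O; last first.
    exists m => c'; rewrite inE => /orP[/eqP ->|cs]; first by rewrite (negbTE nca).
    exact: IH.
  have [m' mE] := Esub _ _ ca; exists (maxn m m') => c' + c'a j.
  rewrite inE geq_max => /orP[/eqP ->|cs] /andP[mj mj']; first exact: mE.
  exact: IH.
have /choice[nx nxP] : forall am : W * nat, exists j, (am.2 <= j)%N /\ E am.1 j.
  by move=> [a m]; have [j mj Ej] := Einf a m; exists j.
(* In late blocks, the segment of this length will contain the unknown index and the rank of [w]. *)
pose p a (n : nat) (w : seq bool) := psi a (pickle (n, w)).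
pose h a n w := maxn (p a n w) (kap (a, p a n w)).
pose st a n w := child b w (nx (a, h a n w)) [::].
have /choice[kk kkP] : forall anw : W * nat * seq bool, exists k, forall o : nat -> W,
    (forall i, (i <= k)%N -> o i \in segment eps anw.1.1
      (p anw.1.1 anw.1.2 (iter i (st anw.1.1 anw.1.2) anw.2))) ->
    exists2 i, (i < k)%N & ~~ (o i.+1 < o i)%O.
  by move=> anw; exact: bounded_descent.
pose pth a n w := iter (kk (a, n, w)) (st a n) w.
have pth_cat a n u : exists v, pth a n u = u ++ v.
  rewrite /pth; elim: (kk _) => [|k [v IH]] /=; first by exists [::]; rewrite cats0.
  by rewrite IH /st; eexists; rewrite /child -catA.
pose ok a n w j := E a j /\ (h a n w <= j)%N.
exists (fun a n => grown b (pth a n [::]) (ok a n) (pth a n)); split=> [a|N thN].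
  split=> [n c|m]; last by exists m => //; exists (pth a m [::]); exact: grown_root.
  apply: grown_crowded => // w m.
  have [] := nxP (a, maxn m (h a n w)); rewrite /= geq_max => /andP[mj hj] Ej.
  by exists (nx (a, maxn m (h a n w))).
have /choice[D DP] : forall s, exists D : (set (seq bool)) * (seq bool -> W) * W * (seq bool -> nat),
    (forall w, D.1.1.1 w -> ~ N s w) /\ forall w j, (D.2 w <= j)%N -> E D.1.2 j ->
    (D.1.1.1 w -> D.1.1.1 (child b w j [::])) /\
    (~ D.1.1.1 w -> (D.1.1.2 (child b w j [::]) < D.1.1.2 w)%O).
  by move=> s; have [M [rk [x [H HP]]]] := escape (thN s); exists (M, rk, x, H).
pose M s := (D s).1.1.1; pose rk s := (D s).1.1.2; pose x s := (D s).1.2; pose H s := (D s).2.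
(* The search coded by [pickle (n, w)] ends when the list contains the index and the rank of [w] and
   its length bounds [H]; the first [n.+1] entries tell which set [N t] is meant. *)
pose T i s := if unpickle i is Some nw then
    let t := take nw.1.+1 s in
    [/\ (nw.1 < size s)%N, (H t nw.2 <= size s)%N, x t \in s & rk t nw.2 \in s]
  else True.
pose c := pair_closure (fun _ s => x s)
  (fun k s => if unpickle k is Some w then rk s w else x s).
have segP a k : forall i, (i < k)%N -> eps a i \in segment eps a k.
  by move=> i ik; apply/mapP; exists i; rewrite ?mem_iota.
have [a ca i|a [Ra ca [N0 N0P]]] := psiP T c.
  rewrite /T; case ui: (unpickle i : option (nat * seq bool)) => [[n w]|]; last by exists 0%N.
  have nm := closed_under_nonmin ca; have [_ eS] := epsP nm.
  have [cx crk] := closed_under_pair ca; set s := segment eps a n.+1.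
  have sa : all (fun z => (z < a)%O) s by exact: segment_below.
  have [k1 k1P] := eS _ (cx 0%N s sa).
  have [k2 k2P] : exists k, eps a k = rk s w.
    by apply: eS; have := crk (pickle w) s sa; rewrite pickleK.
  exists (maxn (maxn n.+1 (H s w)) (maxn k1.+1 k2.+1)) => /=; rewrite take_segment ?leq_max ?leqnn //.
  rewrite -/s -k1P -k2P size_mkseq; split; rewrite ?segP //; lia.
have nm := closed_under_nonmin ca; have [cx crk] := closed_under_pair ca.
exists a; split=> //.
(* From [n0] on, the code [pickle (n, w)] is at least [N0] for every word [w]. *)
pose n0 := (\max_(i < N0) if (unpickle i : option (nat * seq bool)) is Some nw then nw.1.+1 else 0)%N.
exists n0 => n n0n.
set s := segment eps a n.+1.
have sa : all (fun z => (z < a)%O) s by exact: segment_below.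
have key w : [/\ (H s w <= p a n w)%N, x s \in segment eps a (p a n w) &
    rk s w \in segment eps a (p a n w)].
  have [|m mp] := N0P (pickle (n, w)).
    rewrite leqNgt; apply/negP => lt.
    have := @leq_bigmax _ (fun i : 'I_N0 => (if (unpickle i : option (nat * seq bool)) is Some nw
      then nw.1.+1 else 0)%N) (Ordinal lt).
    by rewrite -/n0 /= pickleK => nn0; have := leq_trans nn0 n0n; rewrite /= ltnn.
  rewrite /T pickleK /= size_mkseq => -[nm' Hm xm rm]; rewrite take_segment // -/s in Hm xm rm.
  have sub z : z \in segment eps a m -> z \in segment eps a (p a n w).
    by rewrite -(take_segment _ _ mp) => /mem_take.
  by split; [exact: leq_trans mp|exact: sub|exact: sub].
have stepP w j : ok a n w j -> (M s w -> M s (child b w j [::])) /\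
    (~ M s w -> (rk s (child b w j [::]) < rk s w)%O).
  move=> [Ej]; rewrite /h geq_max => /andP[pj kj]; have [Hp xp _] := key w.
  apply: (DP s).2; first exact: leq_trans pj.
  exact: (kapP (a, p a n w) (x s) xp (cx 0%N s sa) j kj Ej).
have okst w : ok a n w (nx (a, h a n w)) by have [] := nxP (a, h a n w).
(* [M] is preserved along the path, so a path ending outside [M] never was in [M], and its ranks
   would decrease at every step, against the choice of [kk]. *)
have pthM w : M s (pth a n w).
  apply: contrapT => nMk.
  have nMi i : (i <= kk (a, n, w))%N -> ~ M s (iter i (st a n) w).
    move=> ik Mi; apply: nMk; rewrite /pth -(subnK ik) iterD.
    by elim: (_ - i)%N => //= l IHl; exact: (stepP _ _ (okst _)).1.
  have [i ik|i ik /negP[]] := kkP (a, n, w) (fun i => rk s (iter i (st a n) w)).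
    by have [_ _] := key (iter i (st a n) w).
  by apply: (stepP _ _ (okst _)).2; exact/nMi/ltnW.
move=> w; have [MN _] := DP s; move=> gw; apply: MN.
elim: gw => [|w' j _ IH okj|w' j _ IH]; [exact: pthM| |exact: pthM].
exact: (stepP _ _ okj).1.
Qed.

End Ppoint.

(** * The gruff ultrafilter *)

Section Split.
Context {d : Order.disp_t} {W : orderType d}.
Hypothesis hW : is_omega1 W.

(** A Cantor-Bendixson analysis above a bound [r] of the largest crowded subset [K] of [S]: points
    that are not limits from both sides are removed transfinitely, and [T b] collects those failing
    on side [b]. A point of least rank in a [b]-crowded subset of [T b] would not fail. *)
Lemma scanty_split S : scanty S -> exists (T : bool -> set rat) r,
  (forall x, S x -> r < x -> exists b, T b x) /\
  forall b C, C `<=` T b -> crowded_on b C -> forall x, ~ C x.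
Proof.
move=> sS.
pose K := [set x | exists C, [/\ C `<=` S, crowded C & C x]].
have cK : crowded K.
  move=> b x [C [CS cC Cx]] e e0; have [y Cy sy] := cC b x Cx e e0.
  by exists y => //; exists C.
have [r rK] : exists r, forall x, K x -> x <= r.
  apply: contrapT => /forallNP nr; apply: sS; exists K; split=> //.
    by move=> x [C [CS _ Cx]]; exact: CS.
  move=> r; have /existsNP[x /not_implyP[Kx /negP]] := nr r.
  by rewrite -ltNge => rx; exists x.
pose S0 := S `&` [set x | r < x].
pose lim b (T : set rat) x :=
  forall e, 0 < e -> exists2 y, T y & side b x y /\ `|y - x| < e.
have limS b T T' x : T `<=` T' -> lim b T x -> lim b T' x.
  by move=> TT' l e /l[y Ty sy]; exists y => //; exact: TT'.
have [||rk rkP] := @monotone_rank _ _ hW (rat : countType)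
    (fun D => [set x | S0 x -> exists b, ~ lim b (S0 `\` D) x]).
- move=> A B AB x Ax /Ax[b nl]; exists b => l; apply: nl; apply: limS l.
  by move=> y [S0y nBy]; split=> // /AB.
(* A nonempty remainder outside [D] would be crowded, hence part of [K], which has no point above
   [r]. *)
- move=> D GD x; apply: contrapT => nDx.
  have nG y : ~ D y -> S0 y /\ forall b, lim b (S0 `\` D) y.
    move=> nDy; have /not_implyP[S0y nl] : ~ (S0 y -> exists b, ~ lim b (S0 `\` D) y).
      by move=> h; apply/nDy/GD.
    by split=> // b; apply: contrapT => l; apply: nl; exists b.
  have [S0x _] := nG x nDx; have [_] := S0x; rewrite /= ltNge => /negP; apply.
  apply: rK; exists (S0 `\` D); split=> //; first by move=> y [[]].
  by move=> b y [_ nDy]; have [_] := nG y nDy; exact.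
exists (fun b => [set x | S0 x /\ ~ lim b (S0 `\` [set y | (rk y < rk x)%O]) x]), r.
split=> [x Sx rx|b C CT cC].
  by have [|b nl] := rkP x; [|exists b].
suff H : forall w x, rk x = w -> ~ C x by move=> x; exact: H erefl.
elim/(omega1_ind hW) => w IH x xw Cx; have [_] := CT x Cx; apply.
apply: limS (cC x Cx) => y Cy; split; first by have [] := CT y Cy.
by rewrite /= xw => /IH/(_ y erefl).
Qed.

End Split.

(** * The filter generated by a tower *)

Section GruffFilter.
Context {d : Order.disp_t} {W : orderType d}.
Hypothesis hW : is_omega1 W.
Variable X : W -> set rat.
Hypothesis Xclosed : forall a, closed (X a : set rat^o).
Hypothesis Xcrowded : forall a, crowded (X a).
Hypothesis Xunbounded : forall a, unbounded_rat (X a).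
Hypothesis Xsub : forall a b, (b < a)%O -> almost_sub (X a) (X b).
Hypothesis Xnat : forall a, (exists b, (b < a)%O) -> forall n : nat, ~ X a n%:R.
Hypothesis Xdecides : forall A, exists a,
  almost_sub (X a) A \/ almost_sub (X a) (~` A).

Definition tower_filter : set_system rat^o := [set A | exists a, almost_sub (X a) A].

Lemma almost_sub_le a b A : (b <= a)%O -> almost_sub (X b) A -> almost_sub (X a) A.
Proof.
rewrite le_eqVlt => /orP[/eqP ->//|/Xsub[r rP] [r' r'P]].
exists (Num.max r r') => x Xx; rewrite gt_max => /andP[rx rx'].
by apply: r'P => //; exact: rP.
Qed.

Lemma almost_subI a A B : almost_sub (X a) A -> almost_sub (X a) B ->
  almost_sub (X a) (A `&` B).
Proof.
move=> [r rP] [r' r'P]; exists (Num.max r r') => x Xx; rewrite gt_max => /andP[rx rx'].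
by split; [exact: rP|exact: r'P].
Qed.

Lemma tower_filterI A B : tower_filter A -> tower_filter B -> tower_filter (A `&` B).
Proof.
move=> [a aA] [b bB]; exists (Order.max a b); apply: almost_subI.
  by apply: almost_sub_le aA; rewrite le_max lexx.
by apply: almost_sub_le bB; rewrite le_max lexx orbT.
Qed.

Lemma tower_filter_ultra : UltraFilter tower_filter.
Proof.
have [a0 _] := Xdecides setT.
have TF : ProperFilter tower_filter.
  apply: Build_ProperFilter.
    by move=> [a [r r0]]; have [x Xx rx] := Xunbounded a r; exact: (r0 x).
  constructor; first by exists a0, 0.
    exact: tower_filterI.
  by move=> A B AB [a [r rA]]; exists a, r => x Xx rx; exact/AB/rA.
split=> // F FF uF; apply/seteqP; split=> // A FA.
have [a [aA|aA]] := Xdecides A; first by exists a.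
by have /filter_ex[x []] : F (A `&` ~` A) by apply: filterI => //; apply: uF; exists a.
Qed.

(** Each member contains the tail of some [X a] beyond an integer; this tail is closed because [X a]
    misses that integer, and it inherits crowdedness. *)
Lemma tower_filter_gruff : gruff tower_filter.
Proof.
split; first exact: tower_filter_ultra.
  move=> x ux; have : tower_filter [set x] by rewrite ux.
  move=> [a [r rP]]; have [y Xy] := Xunbounded a (Num.max r x).
  by rewrite gt_max => /andP[ry xy]; have := rP y Xy ry => /= yx; rewrite yx ltxx in xy.
move=> A [a0 aA].
(* Moving strictly above [a0] makes [a] nonminimal, as [Xnat] requires. *)
have [bnd bndP] := omega1_bound hW; pose a := bnd [set a0].
have a0a : (a0 < a)%O by apply: bndP => //; exact: countable1.
have [r rA] := almost_sub_le (ltW a0a) aA.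
pose n := (Num.truncn r).+1; have rn : r < n%:R by exact: truncnS_gt.
pose P : set rat^o := X a `&` [set x | n%:R < x].
have cP : closed P.
  rewrite -[P]setCK; apply: open_closedC; rewrite openE => q nPq.
  have [Xq|nXq] := pselect (X a q); last first.
    have : nbhs (q : rat^o) (~` (X a : set rat^o)).
      by apply: open_nbhs_nbhs; split=> //; exact: closed_openC.
    by apply: filterS => y nXy [].
  have qn : q < n%:R.
    rewrite lt_neqAle leNgt andbC; apply/andP; split.
      by apply/negP => nq; apply: nPq.
    apply/eqP => qn; move: Xq; rewrite qn; apply: Xnat.
    by exists a0.
  apply/nbhs_ballP; exists (n%:R - q); first by rewrite /= subr_gt0.
  move=> y; rewrite /ball /= ltr_distlC => /andP[_ yn] [_ /=]; lra.
exists P; split.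
- split=> //; apply/seteqP; split=> x.
    move=> lx; apply: cP => B /lx[y [_ Py By]]; by exists y.
  move=> [Xx nx] U /nbhs_ballP[e /= e0 eU].
  have [y Xy [/= xy ye]] := Xcrowded true Xx e0.
  exists y; split; [by rewrite gt_eqF|by split=> //; exact: lt_trans nx xy|].
  by apply: eU; rewrite /ball /= distrC.
- by exists a, n%:R.
- by move=> x [Xx nx]; apply: rA => //; exact: lt_trans nx.
Qed.

End GruffFilter.

Theorem theorem2p4 (d : Order.disp_t) (W : orderType d) (hW : is_omega1 W) :
  diamond_rP W -> exists u : set_system rat^o, gruff u.
Proof.
move=> dia; have [eps epsP] := omega1_enum hW.
have [G [Gcu gG]] := diamond_guessing hW epsP dia.
have [R [gR Rinj]] := guessing_roles hW epsP gG.
have [E EP] := ppoint_exists hW epsP Gcu gG.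
(* Role 0 decides sets up to scanty errors; the roles of [true] and [false] avoid sets without
   right-crowded and without left-crowded subsets. *)
pose role (b : bool) : 'I_3 := if b then inord 1 else inord 2.
have /choice[Z ZP] := fun b => avoidance hW epsP EP b Gcu (gR (role b)).
pose V a := if `[< R (role true) a >] then Z true a
  else if `[< R (role false) a >] then Z false a else G a.
have role_inj : injective role.
  by case=> -[] // /(congr1 val); rewrite /= !inordK.
have VZ b a : R (role b) a -> V a = Z b a.
  rewrite /V; case: asboolP => [Rt|nRt]; last first.
    case: b => // Rf; by rewrite asboolT.
  by move=> /(Rinj _ _ _ Rt)/role_inj <-.
have VG a : R ord0 a -> V a = G a.
  have n0 b : R ord0 a -> R (role b) a -> False.
    by move=> R0 /(Rinj _ _ _ R0)/(congr1 val); case: b; rewrite /= inordK.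
  by move=> R0; rewrite /V !asboolF // => /(n0 _ R0).
have Vcu a : blocks_crowded (V a) /\ blocks_unbounded (V a).
  by rewrite /V; case: ifP => _; [exact: (ZP true).1|case: ifP => _; [exact: (ZP false).1|]].
have [X [Xg Xsub tX XV]] := tower hW epsP Vcu.
have tf a k : tame (mkseq (X \o eps a) k) by rewrite -map_segment; exact: tX.
have kill S : scanty S -> exists a, almost_sub (X a) (~` S).
  move=> /(scanty_split hW)[T [r [ST thT]]].
  have killT b : exists a, almost_sub (X a) (~` T b).
    (* Requiring the piece to be crowded and nonempty makes [N s] thin for every list [s]. *)
    pose N s := [set w | [/\ crowded (piece (map X s)), piece (map X s) !=set0 &
      T b (node (piece (map X s)) w)]].
    have [s C CN cC w Cw|a [Ra nm [n0 n0P]]] := (ZP b).2 N.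
      have [cP P0 _] := CN w Cw.
      apply: (thT b (node (piece (map X s)) @` C) _ (image_node_crowded cP P0 cC)).
        by move=> _ [u Cu <-]; have [] := CN u Cu.
      by exists w; [exact: Cw|reflexivity].
    exists a, (index_at (X \o eps a) n0)%:R => x /(XV a nm) xV nx Tx.
    have [m [w [nm' Vw xw]]] := spread_above (tf a) xV nx.
    rewrite (VZ _ _ Ra) in Vw; apply: (n0P m nm' w Vw).
    by split; rewrite map_segment; [exact: piece_crowded|exact: piece_nonempty|rewrite -xw].
  have [[a aT] [a' aF]] := (killT true, killT false); exists (Order.max a a').
  have [|r1 r1P] := almost_sub_le Xsub (a := Order.max a a') _ aT.
    by rewrite le_max lexx.
  have [|r2 r2P] := almost_sub_le Xsub (a := Order.max a a') _ aF.
    by rewrite le_max lexx orbT.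
  exists (Num.max r (Num.max r1 r2)) => x Xx; rewrite !gt_max => /and3P[rx rx1 rx2] Sx.
  by have [[] Tx] := ST x Sx rx; [exact: (r1P x)|exact: (r2P x)].
exists (tower_filter X); apply: (tower_filter_gruff hW).
- by move=> a; have [] := Xg a.
- by move=> a; have [] := Xg a.
- by move=> a; have [] := Xg a.
- exact: Xsub.
- move=> a nm n /(XV a nm)[m _ [w _ wn]].
  have := node_block (tf a) m w; rewrite wn /block /between /= !ltr_nat; lia.
(* Reaping leaves a scanty error on one side of [A], which [kill] then confines to a bounded set. *)
move=> A; have [a ra] := tower_reaps hW tX XV (gR ord0) VG A.
have sub B : scanty (X a `\` B) -> exists c, almost_sub (X c) B.
  move=> /kill[c cB]; exists (Order.max a c).
  have [|r1 r1P] := almost_sub_le Xsub (a := Order.max a c) _ cB.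
    by rewrite le_max lexx orbT.
  have aa : almost_sub (X a) (X a) by exists 0.
  have [|r2 r2P] := almost_sub_le Xsub (a := Order.max a c) _ aa.
    by rewrite le_max lexx.
  exists (Num.max r1 r2) => x Xx; rewrite gt_max => /andP[rx1 rx2].
  by apply: contrapT => nB; apply: (r1P x Xx rx1); split=> //; exact: r2P.
case: ra => [/sub[c cA]|sA]; first by exists c; left.
have [|c cA] := sub (~` A); first by rewrite setDE setCK.
by exists c; right.
Qed.
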